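(* Let $\mathbf{k}$ be a field, let $U$ be a $3$-dimensional $\mathbf{k}$-vector space with basis $x,y,z$, let $U_0$ be the subspace spanned by $y$ and $z$, and let $R=\operatorname{Sym}_\bullet U=\mathbf{k}[x,y,z]$ (standard graded). Let $n$ be a positive integer, let $\Phi_{2n-1}\in D_{2n-1}U^*$, and let $I=\operatorname{ann}_{\operatorname{Sym}U}(x(\Phi_{2n-1}))=\{\mu\in R\mid \mu(x(\Phi_{2n-1}))=0\}$. Let $N=\binom{n+1}{2}$, let $m_1,\dots,m_N$ be the ordered basis of $\operatorname{Sym}_{n-1}U$ and $m_{0,1},\dots,m_{0,n+1}$ the ordered basis of $\operatorname{Sym}_nU_0$ described in the context. Let $\mathbf{p}$ be the $N\times N$ matrix with $(i,j)$ entry $\Phi_{2n-1}(xm_im_j)$ and $\mathbf{r}$ the $N\times(n+1)$ matrix with $(i,j)$ entry $\Phi_{2n-1}(m_im_{0,j})$. Then: (a) $I$ is linearly presented if and only if $\mathbf{p}$ is invertible. (b) If $\mathbf{p}$ is invertible, define: $A_0$ = the $(n+1)\times(n+1)$ matrix $\mathbf{r}^{\rm T}\mathbf{p}^{-1}\mathbf{r}$ with row $n+1$ and column $1$ deleted; $A'=A_0-A_0^{\rm T}$; $A=xA'$; $B_0$ = the right-most $n$ columns of the $(n+1)\times N$ matrix $\mathbf{r}^{\rm T}\mathbf{p}^{-1}$; $B_1=\left[\,0_{n\times 1}\mid B_0\text{ with row } n+1 \text{ deleted}\,\right]-\left[\,B_0\text{ with row }1\text{ deleted}\mid 0_{n\times1}\,\right]$;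 $B_2=\left[\,zI_n\mid 0_{n\times1}\,\right]-\left[\,0_{n\times1}\mid yI_n\,\right]$; $B=xB_1+B_2$; $D_0$ = the $(n+1)\times(n+1)$ matrix $\begin{bmatrix}0_{n\times1}& Q\\ 0_{1\times1}&0_{1\times n}\end{bmatrix}$ where $Q$ is the bottom-right $n\times n$ submatrix of $\mathbf{p}^{-1}$; $D=x(D_0-D_0^{\rm T})$; and $$b_2=\begin{bmatrix}A&B\\ -B^{\rm T}&D\end{bmatrix}.$$ Let $b_1$ be the row vector of signed maximal order Pfaffians of $b_2$ and $b_3=b_1^{\rm T}$. Then the minimal homogeneous resolution of $R/I$ by free $R$-modules is $$0\to R(-2n-1)\xrightarrow{b_3}R(-n-1)^{2n+1}\xrightarrow{b_2}R(-n)^{2n+1}\xrightarrow{b_1}R.$$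
   Context: For a finite-dimensional $\mathbf{k}$-vector space $V$, $D_iV^*=\operatorname{Hom}_{\mathbf{k}}(\operatorname{Sym}_iV,\mathbf{k})$ and $D_\bullet V^*=\bigoplus_{i\ge0}D_iV^*$. The ring $\operatorname{Sym}_\bullet U$ acts on $D_\bullet U^*$: for $u\in\operatorname{Sym}_iU$ and $w\in D_jU^*$, $u(w)\in D_{j-i}U^*$ is defined by $u(w)(v)=w(vu)$ for $v\in\operatorname{Sym}_{j-i}U$ (and $u(w)=0$ if $i>j$); for $u\in \operatorname{Sym}_jU$ and $w\in D_jU^*$, $u(w)=w(u)\in\mathbf{k}$. Ordered bases: the basis of $\operatorname{Sym}_iU$ consists of the monomials $x^ay^bz^c$ with $a+b+c=i$, where $x^ay^bz^c$ precedes $x^\alpha y^\beta z^\gamma$ iff $\alpha<a$, or $\alpha=a$ and $\beta<b$ (so the order is $x^i,x^{i-1}y,x^{i-1}z,x^{i-2}y^2,x^{i-2}yz,x^{i-2}z^2,\dots,y^i,y^{i-1}z,\dots,z^i$); the basis of $\operatorname{Sym}_iU_0$ is $y^i,y^{i-1}z,\dots,yz^{i-1},z^i$. $I_a$ is the $a\times a$ identity matrix and $0_{a\times b}$ the $a\times b$ zero matrix. For an $m\times m$ alternating matrix $M$ ($M^{\rm T}=-M$, zero diagonal) with $m$ odd, the row vector of signed maximal order Pfaffians is $[M_1,\dots,M_m]$ where $M_j=(-1)^{j+1}$ times the Pfaffian of $M$ with row and column $j$ deleted. A homogeneous ideal $I$ is linearly presented if, in the minimal homogeneous free resolution $\cdots\to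 F_2\xrightarrow{d_2}F_1\xrightarrow{d_1}F_0$ of $R/I$, all entries of $d_2$ are linear forms.
   Formalization: In (a), ''linearly presented'' is read with F_0 = R, so the unit ideal I = R (the case x(Φ) = 0, where p = 0 and R/I = 0 has the zero resolution, making the condition vacuous) counts as not linearly presented; otherwise (a) would fail there. *)

(* Defs.v *)
From HB Require Import structures.
From mathcomp Require Import all_boot all_order all_algebra.
From mathcomp Require Import mpoly.
From mathcomp Require Import zify.

Set Implicit Arguments.
Unset Strict Implicit.
Unset Printing Implicit Defensive.

Import Order.TTheory GRing.Theory Num.Theory.
Local Open Scope ring_scope.

Section Defs.
Variable k : fieldType.

Local Notation R := {mpoly k[3]}.
Definition vx : R := 'X_0.
Definition vy : R := 'X_1.
Definition vz : R := 'X_2.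

(* An element w of D_d U^* = Hom(Sym_d U, k) is given by its values on the
   monomial basis of Sym_d U: a function on monomials (exponent vectors);
   only the values on monomials of degree d matter.  More generally a
   function w : 'X_{1..3} -> k represents the element of D_. U^* whose
   degree-e component takes value w m on the monomial m of degree e. *)
Definition Dform := 'X_{1..3} -> k.

Definition Deval (d : nat) (w : Dform) (u : R) : k :=
  \sum_(m <- msupp u | mdeg m == d) u@_m * w m.

(* The action of mu in Sym U on w in D_j U^*, as an element of D_. U^*:
   its value on a monomial v (of degree e) is w(v mu) (degree-j part),
   i.e. the component of degree e of mu(w) is mu_{j-e}(w) evaluated at v. *)
Definition Dact (j : nat) (mu : R) (w : Dform) : Dform :=
  fun v => Deval j w ('X_[v] * mu).

Definition annI (n : nat) (Phi : Dform) : R -> Prop :=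
  fun mu => forall v, Dact (2 * n - 2) mu (Dact (2 * n - 1) vx Phi) v = 0.

(* ordered monomial basis of Sym_d U:
   x^d, x^{d-1}y, x^{d-1}z, x^{d-2}y^2, ..., z^d *)
Definition symU_basis (d : nat) : seq R :=
  [seq 'X_0 ^+ a * 'X_1 ^+ b * 'X_2 ^+ (d - a - b)
     | a <- rev (iota 0 d.+1), b <- rev (iota 0 (d - a).+1)].

Definition Nn (n : nat) := 'C(n.+1, 2).

Definition mbas (n : nat) (i : 'I_(Nn n)) : R := nth 0 (symU_basis n.-1) i.
Definition m0bas (n : nat) (j : 'I_n.+1) : R := 'X_1 ^+ (n - j) * 'X_2 ^+ j.

Definition pmat (n : nat) (Phi : Dform) : 'M[k]_(Nn n) :=
  \matrix_(i, j) Deval (2 * n - 1) Phi (vx * mbas i * mbas j).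
Definition rmat (n : nat) (Phi : Dform) : 'M[k]_(Nn n, n.+1) :=
  \matrix_(i, j) Deval (2 * n - 1) Phi (mbas i * m0bas j).

Definition cmx {r c} (M : 'M[k]_(r, c)) : 'M[R]_(r, c) := map_mx (fun a => a%:MP) M.

Lemma rc_lt (c l : nat) (j : 'I_l) : (l <= c -> c - l + j < c)%N.
Proof. move=> h; have := ltn_ord j; lia. Qed.

Lemma n_le_Nn (n : nat) : (n <= Nn n)%N.
Proof. rewrite /Nn binS bin1; case: n => //= n; rewrite bin2; nia. Qed.

Definition rcols {T : Type} {r c : nat} (l : nat) (h : (l <= c)%N) (M : 'M[T]_(r, c))
  : 'M[T]_(r, l) := \matrix_(i, j) M i (Ordinal (rc_lt j h)).

Definition brsub {T : Type} {c : nat} (l : nat) (h : (l <= c)%N) (M : 'M[T]_c)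
  : 'M[T]_l := \matrix_(i, j) M (Ordinal (rc_lt i h)) (Ordinal (rc_lt j h)).

Section Construction.
Variables (n : nat) (Phi : Dform).
Let p := pmat n Phi.
Let r := rmat n Phi.
Let pinv := invmx p.

Definition A0 : 'M[k]_n := row' ord_max (col' ord0 (r^T *m pinv *m r)).
Definition Amx : 'M[R]_n := vx *: cmx (A0 - A0^T).
Definition B0 : 'M[k]_(n.+1, n) := rcols (n_le_Nn n) (r^T *m pinv).
Definition B1 : 'M[k]_(n, n.+1) :=
  row_mx (0 : 'M_(n, 1)) (row' ord_max B0)
  - castmx (erefl n, addn1 n) (row_mx (row' ord0 B0) (0 : 'M_(n, 1))).
Definition B2 : 'M[R]_(n, n.+1) :=
  castmx (erefl n, addn1 n) (row_mx (vz%:M : 'M[R]_n) (0 : 'M_(n, 1)))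
  - row_mx (0 : 'M_(n, 1)) (vy%:M : 'M[R]_n).
Definition Bmx : 'M[R]_(n, n.+1) := vx *: cmx B1 + B2.
Definition Qmx : 'M[k]_n := brsub (n_le_Nn n) pinv.
Definition D0 : 'M[k]_n.+1 :=
  castmx (addn1 n, erefl n.+1)
    (block_mx (0 : 'M_(n, 1)) Qmx (0 : 'M_(1, 1)) (0 : 'M_(1, n))).
Definition Dmx : 'M[R]_n.+1 := vx *: cmx (D0 - D0^T).

Definition b2 : 'M[R]_(n + n.+1) := block_mx Amx Bmx (- Bmx^T) Dmx.
End Construction.
End Defs.

(* Pfaffians, over any commutative ring, via the expansion along the first row:
   Pf(a) = sum_{j=2}^{s} (-1)^j a_{1j} Pf(a with rows/cols 1 and j deleted),
   Pf of the empty matrix = 1, Pf of a matrix of odd size = 0.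
   Matrices are given as functions nat -> nat -> T (0-indexed). *)
Definition minor2 {T : Type} (a : nat -> nat -> T) (j : nat) : nat -> nat -> T :=
  let f i := if (i < j)%N then i.+1 else i.+2 in fun i l => a (f i) (f l).

Fixpoint pfaff {T : comPzRingType} (s : nat) (a : nat -> nat -> T) : T :=
  match s with
  | 0 => 1
  | 1 => 0
  | s'.+2 => \sum_(j < s'.+1) (-1) ^+ j * a 0%N j.+1 * pfaff s' (minor2 a j)
  end.

Definition mx_fun {T : comPzRingType} {m : nat} (M : 'M[T]_m) : nat -> nat -> T :=
  fun i j => match @insub _ (fun i => (i < m)%N) 'I_m i, @insub _ (fun i => (i < m)%N) 'I_m j with
             | Some i', Some j' => M i' j'
             | _, _ => 0
             end.

Definition pfaffian {T : comPzRingType} {m : nat} (M : 'M[T]_m) : T := pfaff m (mx_fun M).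

(* row vector of signed maximal order Pfaffians: M_j = (-1)^(j+1) Pf(M without row/col j),
   j 1-indexed, i.e. (-1)^j for 0-indexed j *)
Definition signed_pfaffians {T : comPzRingType} {m : nat} (M : 'M[T]_m) : 'rV[T]_m :=
  \row_j ((-1) ^+ j * pfaffian (row' j (col' j M))).

Section Res.
Variable k : fieldType.
Local Notation R := {mpoly k[3]}.

(* M : F(-b) -> F(-a), F(-a) = (+)_i R(-a_i), is homogeneous of degree 0:
   entry (i,j) is homogeneous of degree b_j - a_i (zero if b_j < a_i). *)
Definition graded_map {r c} (a : 'I_r -> nat) (b : 'I_c -> nat) (M : 'M[R]_(r, c)) :=
  forall i j, M i j = 0 \/ ((a i <= b j)%N /\ M i j \is (b j - a i)%N.-homog).

Definition in_maxideal {r c} (M : 'M[R]_(r, c)) := forall i j, (M i j)@_0%MM = 0.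

Definition exact_at {r0 r1 r2} (d1 : 'M[R]_(r0, r1)) (d2 : 'M[R]_(r1, r2)) :=
  forall v : 'cV[R]_r1, d1 *m v = 0 <-> exists w, v = d2 *m w.

Definition image_is {r1} (d1 : 'rV[R]_r1) (I : R -> Prop) :=
  forall mu, I mu <-> exists v : 'cV[R]_r1, d1 *m v = mu%:M.

(* F2 --d2--> F1 --d1--> F0 = R is the beginning of a minimal homogeneous
   free resolution of R/I, F1 = (+) R(-a_i), F2 = (+) R(-b_j). *)
Definition min_graded_pres (I : R -> Prop) {r1 r2} (a : 'I_r1 -> nat) (b : 'I_r2 -> nat)
  (d1 : 'rV[R]_r1) (d2 : 'M[R]_(r1, r2)) :=
  [/\ graded_map (fun _ => 0%N) a d1, graded_map a b d2,
      in_maxideal d1 /\ in_maxideal d2, image_is d1 I & exact_at d1 d2].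

Definition linearly_presented (I : R -> Prop) :=
  exists r1 r2 (a : 'I_r1 -> nat) (b : 'I_r2 -> nat) d1 d2,
    @min_graded_pres I r1 r2 a b d1 d2 /\ forall i j, d2 i j \is 1%N.-homog.

Definition min_graded_res3 (I : R -> Prop) {r1 r2 r3}
  (a : 'I_r1 -> nat) (b : 'I_r2 -> nat) (c : 'I_r3 -> nat)
  (d1 : 'rV[R]_r1) (d2 : 'M[R]_(r1, r2)) (d3 : 'M[R]_(r2, r3)) :=
  [/\ min_graded_pres I a b d1 d2, graded_map b c d3, in_maxideal d3,
      exact_at d2 d3 & forall w : 'cV[R]_r3, d3 *m w = 0 -> w = 0].
End Res.

(* Main.v *)
(** Put [phi f = Phi (x f)], so that [I = ann phi], and call [d = n - 1].

    If [I] is linearly presented, splitting a Koszul syzygy between two generators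
    by degree shows that all generators have one degree [a].  The pairing between
    the Koszul homology groups [H_1] and [H_2] of [R / I] with values in the socle
    is nondegenerate, and linearity of the presentation puts [H_2] in degree
    [a + 1]; hence the socle degree [2 n - 2] is [2 a - 2], [a = n], and [I] has no
    form of degree [n - 1], i.e. [p] is invertible.

    If [p] is invertible, [phi] is a perfect pairing in degree [n - 1], which gives
    an explicit basis [gen] of [I_n], made of multiples [x W_i] and of forms
    [y^(n-j) z^j - x u_j].  A single identity ([key_relation]) yields
    [b2 *m gen = 0].  Modulo [x] the matrix [b2] is bidiagonal in [y, z], and the
    kernels of [b2] and of [gen^T] are computed there and lifted by a graded
    Nakayama argument.  The signed Pfaffians are killed by [b2], so they are a
    scalar multiple of [gen]; evaluation at (0, 0, 1) shows the scalar is nonzero.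
    Finally [I] is generated in degree [n], because [I] vanishes in the degrees
    where a generator of higher degree would be detected. *)

(* Exactness is obtained by computing kernels, not from a criterion on ranks and depths. The
   obstacle is that all scalar data in [b2] carry a factor x: modulo x only [B2] and its transpose
   survive, and the first n entries of [gen] vanish. A cycle of [gen^T] is therefore determined,
   modulo x and boundaries, only up to normal forms y^e e_i with e + i < n. These are removed by
   dividing the relation by x once and using the pairing [phi] ([yform_ann]).

   All rows of [b2 *m gen = 0] come from one statement about two functionals with lam (z f) = lam'
   (y f). The upper rows take evaluations of Phi against two monomials of degree n, the lower rows
   take coefficients at two neighbouring monomials of degree n - 1.

   The duality of Koszul classes is used as a Fredholm alternative over the finite-dimensional
   quotient R / I: if x f1 + y f2 + z f3 lies in I and (f1, f2, f3) is orthogonal to all second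
   classes, then it can be moved by a Koszul boundary into I, so the form is in the product of the
   maximal ideal with I. This serves both for the socle degree and for generation in degree n. *)
Require Import Defs.
From HB Require Import structures.
From mathcomp Require Import all_boot all_order all_algebra.
From mathcomp Require Import mpoly.
From mathcomp Require Import zify ring.
Import GRing.Theory.

Set Implicit Arguments.
Unset Strict Implicit.
Unset Printing Implicit Defensive.

Local Open Scope ring_scope.

(** * Pfaffians *)

Section Contraction.
Variable T : comPzRingType.
Implicit Types (h : nat -> T) (F : seq nat -> T) (s : seq nat).

(** Signed sum over the letters of s, each removed and replaced by its value under h. F is an
    arbitrary function on words, so anticommutation is available before any alternation is known. *)
Fixpoint contract h F s : T :=
  if s is x :: s' then h x * F s' - contract h (fun t => F (x :: t)) s' else 0.

Lemma eq_contract h F F' s :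
  (forall t, (size t).+1 = size s -> F t = F' t) -> contract h F s = contract h F' s.
Proof.
elim: s F F' => [|x s IH] F F' eqF //=.
by rewrite eqF //; congr (_ - _); apply: IH => t st; rewrite eqF //= st.
Qed.

Lemma contract0 h s : contract h (fun=> 0) s = 0.
Proof. by elim: s => //= x s ->; rewrite mulr0 subrr. Qed.

Lemma contractB h c1 c2 F1 F2 s :
  contract h (fun t => c1 * F1 t - c2 * F2 t) s =
  c1 * contract h F1 s - c2 * contract h F2 s.
Proof.
elim: s F1 F2 => [|x s IH] F1 F2 /=; first by rewrite !mulr0 subrr.
by rewrite IH; ring.
Qed.

Lemma contractN h F s : contract h (fun t => - F t) s = - contract h F s.
Proof.
elim: s F => [|x s IH] F /=; first by rewrite oppr0.
by rewrite IH; ring.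
Qed.

(** The two cross terms change sign when h and h' are exchanged and cancel when h = h'; this drives
    the inductions for anticommutation and for squares. *)
Lemma contract_contract_cons h h' F x s :
  contract h (contract h' F) (x :: s) =
  h x * contract h' F s - h' x * contract h F s
  + contract h (contract h' (fun t => F (x :: t))) s.
Proof.
rewrite /= -[X in _ = _ + X]mul1r -[X in _ - X](@eq_contract _
  (fun t => h' x * F t - 1 * contract h' (fun u => F (x :: u)) t)).
  by rewrite contractB; ring.
by move=> t _; rewrite mul1r.
Qed.

Lemma contract_anticomm h h' F s :
  contract h (contract h' F) s = - contract h' (contract h F) s.
Proof.
elim: s F => [|x s IH] F; first by rewrite oppr0.
by rewrite !contract_contract_cons IH; ring.
Qed.

(** Anticommutation only shows that twice this value is zero, and 2 may be a zero divisor in T;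
    hence a separate induction. *)
Lemma contract_sq h F s : contract h (contract h F) s = 0.
Proof.
by elim: s F => [|x s IH] F //; rewrite contract_contract_cons IH subrr addr0.
Qed.

Lemma contract_sum h F s :
  contract h F s =
  \sum_(j < size s) (-1) ^+ j * h (nth 0%N s j) * F (take j s ++ drop j.+1 s).
Proof.
elim: s F => [|x s IH] F; first by rewrite big_ord0.
rewrite [size _]/= big_ord_recl /= drop0 expr0 mul1r; congr (_ + _).
by rewrite IH -sumrN; apply: eq_bigr => j _; rewrite exprS /=; ring.
Qed.

(** Only the sign rule for adjacent letters; in characteristic 2 it does not imply vanishing on
    repeated letters, which is [pfl_repeat]. The length is fixed because [pfl n] is controlled only
    on words of length n. *)
Definition alternates n F :=
  forall s1 x y s2, size (s1 ++ [:: x, y & s2]) = n ->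
    F (s1 ++ [:: x, y & s2]) = - F (s1 ++ [:: y, x & s2]).

Lemma contract_alternates n h F : alternates n F -> alternates n.+1 (contract h F).
Proof.
move=> altF s1; elim: s1 n F altF => [|u s1 IH] n F altF x y s2.
  rewrite cat0s => -[sz]; rewrite !cat0s /= opprB !opprD !opprK.
  rewrite (@eq_contract _ (fun t => F [:: x, y & t]) (fun t => - F [:: y, x & t])).
    by rewrite contractN; ring.
  by move=> t st; apply: (altF [::]); rewrite /= st.
rewrite cat_cons => -[sz] /=.
case: n altF sz => [|n] altF sz.
  by move: sz; rewrite size_cat /= addnS.
rewrite altF // (IH n) //; first by ring.
by move=> s x' y' s' sz'; apply: (altF (u :: s)); rewrite /= sz'.
Qed.

End Contraction.

(* The Pfaffian of the submatrix of [a] on the index list [s], [n] being its size.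
   [contract] is contraction with a linear form on the exterior algebra, so
   antisymmetry in [s] comes from the anticommutation of contractions. *)
Section PfaffianList.
Variables (T : comPzRingType) (a : nat -> nat -> T).
Hypothesis a_skew : forall i j, a i j = - a j i.
Hypothesis a_diag : forall i, a i i = 0.

Fixpoint pfl n (s : seq nat) : T :=
  match n, s with
  | 0, _ => 1
  | n'.+2, i :: s' => contract (a i) (pfl n') s'
  | _, _ => 0
  end.

(** Splits off the term that pairs i with j; what remains is a double contraction, antisymmetric in
    i and j. *)
Lemma pfl_swap_head n i j s : size s = n ->
  pfl n.+2 [:: i, j & s] = a i j * pfl n s
    - (if n is n'.+2 then contract (a i) (contract (a j) (pfl n')) s else 0).
Proof.
case: n => [|[|n]] sz; rewrite [LHS]/=.
- by case: s sz.
- by rewrite contract0.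
- by congr (_ - _); apply: eq_contract.
Qed.

Lemma pfl_alternates n : alternates n (pfl n).
Proof.
elim/ltn_ind: n => -[|[|n]] IH s1 x y s2.
- by rewrite size_cat /= addnS.
- by rewrite oppr0.
case: s1 => [|u s1] sz.
  case: sz => sz; rewrite !cat0s !pfl_swap_head // opprB a_skew.
  case: n {IH sz} => [|[|n]]; rewrite ?(contract_anticomm (a x)); ring.
rewrite !cat_cons /=; case: n IH sz => [|n] IH sz.
  by move: sz; rewrite size_cat /=; lia.
apply: (@contract_alternates _ n.+1); last by move: sz => /= -[].

by apply: IH; lia.
Qed.

(** Adjacent exchanges carry the second i next to the head; there the diagonal entry is zero and the
    double contraction is a square. *)
Lemma pfl_repeat n i s : size s = n.+1 -> i \in s -> pfl n.+2 (i :: s) = 0.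
Proof.
move=> + si; case/path.splitPr: si => s1 s2 sz.
elim/last_ind: s1 s2 sz => [|s1 u IH] s2 sz.
  rewrite cat0s pfl_swap_head; last by case: sz.
  by rewrite a_diag mul0r sub0r; case: n {sz} => [|[|n]]; rewrite ?contract_sq oppr0.
rewrite -cats1 -catA cat1s in sz *.
rewrite -[i :: _]/((i :: s1) ++ [:: u, i & s2]) pfl_alternates; last first.
  by rewrite cat_cons /= sz.
by rewrite cat_cons IH ?oppr0 // -sz !size_cat.
Qed.

End PfaffianList.

(** Every iterated minor is the original matrix read along a list of labels, so the recursion on
    minors becomes a recursion on lists. *)
Lemma pfaff_pfl (T : comPzRingType) (a b : nat -> nat -> T) (f : nat -> nat) s :
  (forall i l, (i < s)%N -> (l < s)%N -> b i l = a (f i) (f l)) ->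
  pfaff s b = pfl a s (map f (iota 0 s)).
Proof.
elim/ltn_ind: s b f => -[|[|s]] IH b f eqb //.
rewrite -[RHS]/(contract (a (f 0%N)) (pfl a s) (map f (iota 1 s.+1))).
rewrite contract_sum size_map size_iota.
apply: eq_bigr => j _; have ltj := ltn_ord j.
rewrite (nth_map 0%N) ?size_iota // nth_iota // add1n eqb //.
congr (_ * _).
(* Labels left after deleting the indices 0 and j + 1. *)
set f' := fun i => f (if (i < j)%N then i.+1 else i.+2).
rewrite -[LHS]/(pfaff s (minor2 b j)) (IH s _ _ f'); [|by lia|]; last first.
  by move=> i l lti ltl; rewrite /minor2 eqb //; case: ifP => //; lia.
congr (pfl _ _ _); rewrite -map_take -map_drop -map_cat /f'.
apply: (@eq_from_nth _ 0%N).
  by rewrite !size_map size_cat size_take size_drop !size_iota ltj; lia.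
rewrite size_map size_iota => i lti.
rewrite (nth_map 0%N) ?size_iota // (nth_map 0%N); last first.
  by rewrite size_cat size_take size_drop !size_iota ltj; lia.
congr (f _); rewrite nth_iota // add0n nth_cat size_take size_iota ltj.
case: ifP => h; first by rewrite nth_take // nth_iota //; lia.
by rewrite nth_drop nth_iota; lia.
Qed.

Lemma mx_funE (T : comPzRingType) m (M : 'M[T]_m) (i j : 'I_m) : mx_fun M i j = M i j.
Proof. by rewrite /mx_fun !valK. Qed.

Lemma mx_fun_out (T : comPzRingType) m (M : 'M[T]_m) i j :
  (m <= i)%N || (m <= j)%N -> mx_fun M i j = 0.
Proof.
rewrite /mx_fun; case: insubP => // u lti _; case: insubP => // v ltj _.
by move: lti ltj; lia.
Qed.

(** Entry i of the product is, up to sign, the expansion along its first index of the Pfaffian on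
    the list i, 0, ..., m - 1, in which i is repeated. *)
Lemma signed_pfaffians_mul0 (T : comPzRingType) m (M : 'M[T]_m) :
  M^T = - M -> (forall i, M i i = 0) -> signed_pfaffians M *m M = 0.
Proof.
move=> skM dgM; case: m M skM dgM => [|[|m]] M skM dgM.
- by apply/matrixP => i [].
- apply/matrixP => i j; rewrite !mxE big_ord1 !mxE !ord1 dgM mulr0 //.
pose a := mx_fun M.
have ask i j : a i j = - a j i.
  have [lti|lei] := ltnP i m.+2; last by rewrite /a !mx_fun_out ?lei ?orbT ?oppr0.
  have [ltj|lej] := ltnP j m.+2; last by rewrite /a !mx_fun_out ?lej ?orbT ?oppr0.
  rewrite -[i]/(val (Ordinal lti)) -[j]/(val (Ordinal ltj)) /a !mx_funE.
  by rewrite -[M in LHS]trmxK mxE skM mxE.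
have adg i : a i i = 0.
  have [lti|lei] := ltnP i m.+2; last by rewrite /a !mx_fun_out ?lei ?orbT ?oppr0.
  by rewrite -[i]/(val (Ordinal lti)) /a !mx_funE.
apply/matrixP => i0 i; rewrite !mxE.
have := @pfl_repeat _ a ask adg m.+1 i (iota 0 m.+2).
rewrite size_iota mem_iota /= => /(_ erefl (ltn_ord i)).
rewrite -[LHS]/(contract (a i) (pfl a m.+1) (iota 0 m.+2)) contract_sum size_iota.
(* The expansion has a i j where the product has M j i = - a i j, hence the global sign. *)
move=> /(congr1 -%R); rewrite oppr0 -sumrN => E; apply: etrans E.
apply: eq_bigr => j _; have ltj := ltn_ord j; rewrite !mxE nth_iota // add0n.
rewrite ask /a mx_funE -/a.
rewrite /pfaffian (pfaff_pfl (a := a) (f := bump j)).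
  have -> : take j (iota 0 m.+2) ++ drop j.+1 (iota 0 m.+2) = map (bump j) (iota 0 m.+1).
    apply: (@eq_from_nth _ 0%N).
      by rewrite !size_map size_cat size_take size_drop !size_iota ltj; lia.
    rewrite size_cat size_take size_drop !size_iota ltj => l ltl.
    have ltl' : (l < m.+1)%N by lia.
    rewrite (nth_map 0%N) ?size_iota // nth_iota // nth_cat size_take size_iota ltj.
    case: ifP => h; first by rewrite nth_take // nth_iota // /bump; lia.
    by rewrite nth_drop nth_iota /bump; lia.
  by ring.
move=> p q ltp ltq.
rewrite -[p]/(val (Ordinal ltp)) -[q]/(val (Ordinal ltq)) mx_funE !mxE.
by rewrite -[bump j (Ordinal ltp)]/(val (lift j (Ordinal ltp)))
  -[bump j (Ordinal ltq)]/(val (lift j (Ordinal ltq))) /a mx_funE.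
Qed.

(** * Polynomials and annihilators *)

Section SetVariableToZero.
Variables (k : fieldType) (n : nat).
Local Notation R := {mpoly k[n]}.
Implicit Types (i j : 'I_n) (f g : R).

Definition ev0 i : R -> R := comp_mpoly [tuple (if j == i then 0 else 'X_j) | j < n].

HB.instance Definition _ i := GRing.RMorphism.copy (ev0 i)
  (comp_mpoly [tuple (if j == i then 0 else 'X_j) | j < n]).

Lemma ev0X i j : ev0 i 'X_j = if j == i then 0 else 'X_j.
Proof. by rewrite /ev0 comp_mpolyXU -tnth_nth tnth_mktuple. Qed.

Lemma ev0C i c : ev0 i c%:MP = c%:MP.
Proof. exact: comp_mpolyC. Qed.

Lemma ev0_divX i f : exists q, f = ev0 i f + 'X_i * q.
Proof.
pose P (f : R) := exists q, f = ev0 i f + 'X_i * q.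
have PD f1 f2 : P f1 -> P f2 -> P (f1 + f2).
  by move=> [q1 e1] [q2 e2]; exists (q1 + q2); rewrite rmorphD {1}e1 {1}e2; ring.
have PM f1 f2 : P f1 -> P f2 -> P (f1 * f2).
  move=> [q1 e1] [q2 e2]; exists (q1 * f2 + ev0 i f1 * q2).
  by rewrite rmorphM {1}e1 {1 3}e2; ring.
have PC c : P c%:MP by exists 0; rewrite ev0C mulr0 addr0.
have PX j : P 'X_j.
  rewrite /P ev0X; case: eqP => [->|_]; first by exists 1; rewrite add0r mulr1.
  by exists 0; rewrite mulr0 addr0.
suff PXm (m : 'X_{1..n}) : P 'X_[m].
  elim/mpolyind: f => [|c m p _ _ IHp]; first by rewrite -mpolyC0; apply: PC.
  by apply: (PD _ _ _ IHp); rewrite -mul_mpolyC; apply: PM.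
rewrite mpolyXE_id; apply: big_ind => [|//|j _]; first by rewrite -mpolyC1; apply: PC.
by elim: (m j) => [|e IH]; rewrite ?exprS ?expr0 -?mpolyC1; [apply: PC | apply: PM].
Qed.

Lemma mpolyX_neq0 i : 'X_i != 0 :> R.
Proof. by rewrite -msupp_eq0 msuppX. Qed.

Lemma mulX_inj i f g : 'X_i * f = 'X_i * g -> f = g.
Proof. exact: (mulfI (mpolyX_neq0 i)). Qed.

Lemma ev0_eq0 i f : ev0 i f = 0 -> exists q, f = 'X_i * q.
Proof. by have [q {2}->] := ev0_divX i f => ->; exists q; rewrite add0r. Qed.

Lemma mulX_eq_mulX i j f g : i != j -> 'X_i * f = 'X_j * g ->
  exists h, f = 'X_j * h /\ g = 'X_i * h.
Proof.
move=> ij E; have : ev0 j f = 0.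
  have := congr1 (ev0 j) E; rewrite !rmorphM /= !ev0X eqxx (negbTE ij) mul0r.
  by move/eqP; rewrite mulf_eq0 (negbTE (mpolyX_neq0 i)) => /eqP.
move=> /ev0_eq0[h fE]; exists h; split=> //; apply: (@mulX_inj j).
by rewrite -E fE; ring.
Qed.

Lemma pihomog_Mhomog d e f g : f \is d.-homog ->
  pihomog mdeg (d + e) (f * g) = f * pihomog mdeg e g.
Proof.
move=> hf; have hg := pihomog_partitionE (leqnn (mmeasure mdeg g)).
rewrite {1}hg mulr_sumr raddf_sum /=; set K := mmeasure _ _ in hg *.
transitivity (\sum_(i < K) if i == e :> nat then f * pihomog mdeg i g else 0).
  apply: eq_bigr => i _; have h := dhomogM hf (pihomogP mdeg i g).
  case: eqP => [<-|ie]; first by rewrite pihomog_dE.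
  by rewrite (pihomog_ne0 _ h) // eqn_add2l; apply/eqP.
rewrite -big_mkcond /=; have [ltK|leK] := ltnP e K.
  by rewrite (big_pred1 (Ordinal ltK)).
rewrite big1; last by move=> i /eqP ie; move: (ltn_ord i); rewrite ie ltnNge leK.
rewrite {1}hg raddf_sum /= big1 ?mulr0 // => i _.
by rewrite (pihomog_ne0 _ (pihomogP _ _ _)) // neq_ltn (leq_trans (ltn_ord i)).
Qed.

Lemma pihomog_Mhomog0 d e f g : f \is d.-homog -> (e < d)%N ->
  pihomog mdeg e (f * g) = 0.
Proof.
move=> hf ed; rewrite {1}(pihomog_partitionE (leqnn (mmeasure mdeg g))).
rewrite mulr_sumr raddf_sum big1 //= => i _.
rewrite (pihomog_ne0 _ (dhomogM hf (pihomogP mdeg i g))) //.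
by apply/eqP; lia.
Qed.

Lemma dhomogXU i : ('X_i : R) \is 1.-homog.
Proof. by rewrite dhomogX /= mdeg1. Qed.

End SetVariableToZero.

(** * Exactness of the Koszul complex on x, y, z *)

Section Koszul.
Variable k : fieldType.
Local Notation R := {mpoly k[3]}.
Local Notation x := (vx k).
Local Notation y := (vy k).
Local Notation z := (vz k).

Lemma vx_homog : x \is 1.-homog. Proof. exact: dhomogXU. Qed.
Lemma vy_homog : y \is 1.-homog. Proof. exact: dhomogXU. Qed.
Lemma vz_homog : z \is 1.-homog. Proof. exact: dhomogXU. Qed.

Lemma ev0x_x : ev0 0 x = 0. Proof. by rewrite ev0X. Qed.
Lemma ev0x_y : ev0 0 y = y. Proof. by rewrite ev0X. Qed.
Lemma ev0x_z : ev0 0 z = z. Proof. by rewrite ev0X. Qed.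

Lemma mulx_inj (f g : R) : x * f = x * g -> f = g. Proof. exact: mulX_inj. Qed.

Lemma muly_eq_mulz (f g : R) : y * f = z * g -> exists h, f = z * h /\ g = y * h.
Proof. exact: mulX_eq_mulX. Qed.

(** Modulo x this is a relation between the coprime y and z, which fixes v2 and v3 up to multiples
    of x; cancelling x then gives v1. *)
Lemma koszul1 (v1 v2 v3 : R) : x * v1 + y * v2 + z * v3 = 0 ->
  exists u1 u2 u3, [/\ v1 = y * u3 - z * u2, v2 = z * u1 - x * u3 & v3 = x * u2 - y * u1].
Proof.
move=> E; have := congr1 (ev0 0) E.
rewrite !rmorphD !rmorphM /= ev0x_x ev0x_y ev0x_z mul0r add0r rmorph0 => E0.
have /muly_eq_mulz[u1 [e2 e3]] : y * ev0 0 v2 = z * (- ev0 0 v3).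
  by rewrite mulrN; apply/eqP; rewrite -addr_eq0 E0.
have [q2 d2] := ev0_divX 0 v2; have [q3 d3] := ev0_divX 0 v3.
have e3' : ev0 0 v3 = - (y * u1) by rewrite -e3 opprK.
rewrite e2 -/x in d2; rewrite e3' -/x in d3.
exists u1, q3, (- q2); split; last 2 first.
- by rewrite d2; ring.
- by rewrite d3; ring.
apply: mulx_inj; apply/eqP; rewrite -subr_eq0; apply/eqP; rewrite -E d2 d3; ring.
Qed.

Lemma koszul2 (v1 v2 v3 : R) :
  y * v3 = z * v2 -> z * v1 = x * v3 -> x * v2 = y * v1 ->
  exists t, [/\ v1 = x * t, v2 = y * t & v3 = z * t].
Proof.
move=> E1 E2 E3.
have [|t [e2 e1]] := @mulX_eq_mulX _ _ 0 1 v2 v1 _ E3; first by [].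
exists t; split=> //; apply: mulx_inj; rewrite -E2 e1 /x; ring.
Qed.

End Koszul.

(** The columns of a cokernel of the transposed system are admissible test vectors v, and passing
    these tests puts L in the row space. *)
Lemma fredholm_fin (k : fieldType) (S T : finType) (M : S -> T -> k) (L : S -> k) :
  (forall v : S -> k, (forall j, \sum_i v i * M i j = 0) -> \sum_i v i * L i = 0) ->
  exists h : T -> k, forall i, L i = \sum_j M i j * h j.
Proof.
move=> H.
pose Mm : 'M[k]_(#|S|, #|T|) := \matrix_(i, j) M (enum_val i) (enum_val j).
pose Lm : 'cV[k]_#|S| := \col_i L (enum_val i).
have : (Lm^T <= Mm^T)%MS.
  rewrite submxE; apply/eqP/matrixP => a c; rewrite [RHS]mxE mxE.
  set K := cokermx _.
  rewrite (reindex_onto enum_rank enum_val) /=; last by move=> i _; rewrite enum_valK.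
  rewrite (eq_bigl xpredT) => [|i]; last by rewrite enum_rankK eqxx.
  apply: etrans (H (fun i => K (enum_rank i) c) _).
    by apply: eq_bigr => i _; rewrite !mxE enum_rankK mulrC.
  move=> j; have := mulmx_coker Mm^T.
  move=> /matrixP/(_ (enum_rank j) c); rewrite !mxE => E; apply: etrans E.
  rewrite [RHS](reindex_onto enum_rank enum_val) /=; last by move=> i _; rewrite enum_valK.
  rewrite [RHS](eq_bigl xpredT) => [|i]; last by rewrite enum_rankK eqxx.
  by apply: eq_bigr => i _; rewrite !mxE !enum_rankK mulrC.
case/submxP=> hm Lh; exists (fun j => hm 0 (enum_rank j)) => i.
have := congr1 (fun A : 'rV_#|S| => A 0 (enum_rank i)) Lh; rewrite !mxE enum_rankK => ->.
rewrite (reindex_onto enum_rank enum_val) /=; last by move=> j _; rewrite enum_valK.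
rewrite (eq_bigl xpredT) => [|j]; last by rewrite enum_rankK eqxx.
by apply: eq_bigr => j _; rewrite !mxE !enum_rankK mulrC.
Qed.

(** * The annihilator of a functional concentrated in one degree *)

Section Annihilator.
Variables (k : fieldType) (n : nat).
Local Notation R := {mpoly k[n]}.
Variables (phi : R -> k) (D : nat).
Hypothesis phi_lin : forall c f g, phi (c *: f + g) = c * phi f + phi g.
Hypothesis phi_deg : forall m, mdeg m != D -> phi 'X_[m] = 0.

Lemma phiD f g : phi (f + g) = phi f + phi g.
Proof. by rewrite -[f in LHS]scale1r phi_lin mul1r. Qed.

Lemma phi0 : phi 0 = 0.
Proof. by apply: (addrI (phi 0)); rewrite -phiD !addr0. Qed.

Lemma phiZ c f : phi (c *: f) = c * phi f.
Proof. by rewrite -[c *: f]addr0 phi_lin phi0 addr0. Qed.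

Lemma phiN f : phi (- f) = - phi f.
Proof. by rewrite -scaleN1r phiZ mulN1r. Qed.

Lemma phiB f g : phi (f - g) = phi f - phi g.
Proof. by rewrite phiD phiN. Qed.

Lemma phi_sum I (r : seq I) (P : pred I) (F : I -> R) :
  phi (\sum_(i <- r | P i) F i) = \sum_(i <- r | P i) phi (F i).
Proof. by apply: (big_morph phi phiD phi0). Qed.

(** The largest ideal inside the kernel of phi. *)
Definition ann (f : R) := forall h, phi (h * f) = 0.

Lemma annP f : ann f <-> forall m : 'X_{1..n}, phi ('X_[m] * f) = 0.
Proof.
split=> [Af m|Af h]; first exact: Af.
rewrite (mpolyE h) mulr_suml phi_sum big1 // => m _.
by rewrite -scalerAl phiZ Af mulr0.
Qed.

Lemma ann0 : ann 0. Proof. by move=> h; rewrite mulr0 phi0. Qed.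

Lemma annD f g : ann f -> ann g -> ann (f + g).
Proof. by move=> Af Ag h; rewrite mulrDr phiD Af Ag addr0. Qed.

Lemma annMl f g : ann g -> ann (f * g).
Proof. by move=> Ag h; rewrite mulrA Ag. Qed.

Lemma annMr f g : ann f -> ann (f * g).
Proof. by rewrite mulrC; apply: annMl. Qed.

Lemma annN f : ann f -> ann (- f).
Proof. by move=> Af h; rewrite mulrN phiN Af oppr0. Qed.

Lemma annB f g : ann f -> ann g -> ann (f - g).
Proof. by move=> Af Ag; apply: annD => //; apply: annN. Qed.

Lemma ann_sum I (r : seq I) (P : pred I) (F : I -> R) :
  (forall i, P i -> ann (F i)) -> ann (\sum_(i <- r | P i) F i).
Proof. by move=> AF; apply: big_ind => //; [apply: ann0 | apply: annD]. Qed.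

Lemma annZ c f : ann f -> ann (c *: f).
Proof. by move=> Af; rewrite -mul_mpolyC; apply: annMl. Qed.

Lemma ann_phi f : ann f -> phi f = 0.
Proof. by move=> /(_ 1); rewrite mul1r. Qed.

Lemma phi_homog d f : f \is d.-homog -> d != D -> phi f = 0.
Proof.
move=> hf dD; rewrite (mpolyE f) phi_sum big_seq big1 //= => m fm.
by rewrite phiZ phi_deg ?mulr0 // (dhomog_mf hf fm).
Qed.

Lemma phi_pihomog f : phi f = phi (pihomog mdeg D f).
Proof.
rewrite {1}(pihomog_partitionE (leqnn (mmeasure mdeg f))); set K := mmeasure _ _.
rewrite phi_sum /=.
transitivity (\sum_(i < K | i == D :> nat) phi (pihomog mdeg i f)).
  rewrite [RHS]big_mkcond; apply: eq_bigr => i _; case: eqP => // /eqP iD.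
  exact: phi_homog (pihomogP _ _ _) iD.
have [ltK|leK] := ltnP D K; first by rewrite (big_pred1 (Ordinal ltK)).
rewrite big1; last by move=> i /eqP ie; move: (ltn_ord i); rewrite ie ltnNge leK.
rewrite (pihomog_partitionE (leqnn (mmeasure mdeg f))) raddf_sum phi_sum /= big1 // => i _.
by rewrite (pihomog_ne0 _ (pihomogP _ _ _)) ?phi0 // neq_ltn (leq_trans (ltn_ord i)).
Qed.

Lemma ann_pihomog d f : ann f -> ann (pihomog mdeg d f).
Proof.
move=> Af; apply/annP => m; have hm : ('X_[m] : R) \is (mdeg m).-homog by rewrite dhomogX.
have [mD|mD] := eqVneq (mdeg m + d)%N D.
  by rewrite -(pihomog_Mhomog _ _ hm) mD -phi_pihomog Af.
exact: phi_homog (dhomogM hm (pihomogP _ _ _)) mD.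
Qed.

(** phi sees no degree above D, so finitely many monomials decide membership; this makes
    [fredholm_ann] a finite linear system. *)
Lemma ann_bounded f :
  (forall m : 'X_{1..n < D.+1}, phi ('X_[m] * f) = 0) -> ann f.
Proof.
move=> Af; apply/annP => m; have [mD|mD] := ltnP (mdeg m) D.+1.
  exact: (Af (BMultinom mD)).
have hm : ('X_[m] : R) \is (mdeg m).-homog by rewrite dhomogX.
by rewrite phi_pihomog (pihomog_Mhomog0 _ hm mD) phi0.
Qed.

Lemma ann_high d f : f \is d.-homog -> (D < d)%N -> ann f.
Proof.
by move=> hf Dd h; rewrite phi_pihomog mulrC (pihomog_Mhomog0 _ hf Dd) phi0.
Qed.

(** Self-injectivity of the quotient by [ann phi]: f factors through E modulo [ann phi] once it is
    orthogonal, under phi, to every c that E sends into [ann phi]. *)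
Lemma fredholm_ann a b (E : 'M[R]_(a, b)) (f : 'rV[R]_b) :
  (forall c : 'cV_b, (forall t, ann ((E *m c) t 0)) -> phi ((f *m c) 0 0) = 0) ->
  exists h : 'rV_a, forall s, ann ((f - h *m E) 0 s).
Proof.
move=> H; pose B := 'X_{1..n < D.+1}.
(* An equation is a column of E with a test monomial; an unknown is a coefficient of an entry of h
   on a monomial of degree at most D. *)
pose M (i : 'I_b * B) (j : 'I_a * B) := phi ('X_[j.2] * (E j.1 i.1 * 'X_[i.2])).
pose L (i : 'I_b * B) := phi (f 0 i.1 * 'X_[i.2]).
have [v vM|h hL] := @fredholm_fin k ('I_b * B)%type ('I_a * B)%type M L.
  pose c : 'cV[R]_b := \col_s \sum_(m : B) v (s, m) *: 'X_[m].
  apply: etrans (H c _).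
    rewrite mxE phi_sum /= [LHS](eq_bigr (fun p => v (p.1, p.2) * L (p.1, p.2))).
      rewrite -(pair_bigA _ (fun s m => v (s, m) * L (s, m))) /=.
      apply: eq_bigr => s _; rewrite mxE mulr_sumr phi_sum; apply: eq_bigr => m _.
      by rewrite -scalerAr phiZ.
    by case.
  move=> t; apply: ann_bounded => m; apply: etrans (vM (t, m)).
  rewrite mxE mulr_sumr phi_sum /= [RHS](eq_bigr (fun p => v (p.1, p.2) * M (p.1, p.2) (t, m))).
    rewrite -(pair_bigA _ (fun s m' => v (s, m') * M (s, m') (t, m))) /=.
    apply: eq_bigr => s _; rewrite mxE !mulr_sumr phi_sum; apply: eq_bigr => m' _.
    by rewrite -!scalerAr phiZ.
  by case.
exists (\row_t \sum_(m : B) h (t, m) *: 'X_[m]) => s.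
apply: ann_bounded => m; have := hL (s, m).
rewrite /L /= mulrC !mxE mulrBr phiB => ->.
apply/eqP; rewrite subr_eq0; apply/eqP.
rewrite mulr_sumr phi_sum /= [LHS](eq_bigr (fun p => M (s, m) (p.1, p.2) * h (p.1, p.2))).
  rewrite -(pair_bigA _ (fun t m' => M (s, m) (t, m') * h (t, m'))) /=.
  apply: eq_bigr => t _; rewrite mxE mulr_suml mulr_sumr phi_sum; apply: eq_bigr => m' _.
  rewrite /M /= -scalerAl -scalerAr phiZ mulrC; congr (_ * phi _); ring.
by case.
Qed.

End Annihilator.

(** * Linearly presented annihilators *)

Section LinearPresentation.
Variable k : fieldType.
Local Notation R := {mpoly k[3]}.
Local Notation x := (vx k).
Local Notation y := (vy k).
Local Notation z := (vz k).

(** The Koszul differential, as cross product with (x, y, z). Acting on columns it tests second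
    classes; acting on rows it gives the boundaries, whose addition to (f1, f2, f3) does not change
    x f1 + y f2 + z f3. *)
Definition curl_mx : 'M[R]_3 :=
  \matrix_(i, j) nth 0 (nth [::] [:: [:: 0; - z; y]; [:: z; 0; - x]; [:: - y; x; 0]] i) j.

Definition row3 (f1 f2 f3 : R) : 'rV[R]_3 := \row_j nth 0 [:: f1; f2; f3] j.

Lemma row3_mul f1 f2 f3 (c : 'cV[R]_3) :
  (row3 f1 f2 f3 *m c) 0 0 = f1 * c 0 0 + f2 * c 1 0 + f3 * c 2 0.
Proof.
rewrite mxE !big_ord_recl big_ord0 !mxE /= addr0 addrA.
by congr (_ * c _ _ + _ * c _ _ + _ * c _ _); apply: val_inj.
Qed.

Lemma curl_mulE (c : 'cV[R]_3) :
  [/\ (curl_mx *m c) 0 0 = y * c 2 0 - z * c 1 0,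
      (curl_mx *m c) 1 0 = z * c 0 0 - x * c 2 0 &
      (curl_mx *m c) 2 0 = x * c 1 0 - y * c 0 0].
Proof.
have e0 : ord0 = 0 :> 'I_3 by apply: val_inj.
have e1 : lift ord0 ord0 = 1 :> 'I_3 by apply: val_inj.
have e2 : lift ord0 (lift ord0 ord0) = 2 :> 'I_3 by apply: val_inj.
by split; rewrite mxE !big_ord_recl big_ord0 !mxE /= e0 e1 e2; ring.
Qed.

Lemma mul_curlE (h : 'rV[R]_3) :
  [/\ (h *m curl_mx) 0 0 = z * h 0 1 - y * h 0 2,
      (h *m curl_mx) 0 1 = x * h 0 2 - z * h 0 0 &
      (h *m curl_mx) 0 2 = y * h 0 0 - x * h 0 1].
Proof.
have e0 : ord0 = 0 :> 'I_3 by apply: val_inj.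
have e1 : lift ord0 ord0 = 1 :> 'I_3 by apply: val_inj.
have e2 : lift ord0 (lift ord0 ord0) = 2 :> 'I_3 by apply: val_inj.
by split; rewrite mxE !big_ord_recl big_ord0 !mxE /= e0 e1 e2; ring.
Qed.

Lemma mcoeff00M (p q : R) : (p * q)@_0%MM = p@_0%MM * q@_0%MM.
Proof. exact: (rmorphM (mcoeff 0%MM)). Qed.

Lemma mcoeff00X (i : 'I_3) : ('X_i : R)@_0%MM = 0.
Proof. by rewrite mcoeffX -mdeg_eq0 mdeg1. Qed.

Lemma ord3P (P : 'I_3 -> Prop) : P 0 -> P 1 -> P 2 -> forall i, P i.
Proof.
move=> p0 p1 p2 [[|[|[|//]]] lti].
- by have <- : 0 = Ordinal lti by apply: val_inj.
- by have <- : 1 = Ordinal lti by apply: val_inj.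
- by have <- : 2 = Ordinal lti by apply: val_inj.
Qed.

Lemma const_xyz (f : R) :
  exists f1 f2 f3, f = (f@_0%MM)%:MP + x * f1 + y * f2 + z * f3.
Proof.
suff [c [f1 [f2 [f3 E]]]] : exists c f1 f2 f3, f = c%:MP + x * f1 + y * f2 + z * f3.
  exists f1, f2, f3; suff -> : f@_0%MM = c by [].
  rewrite E !mcoeffD !mcoeff00M !mcoeff00X !mul0r !addr0 mcoeffC eqxx mulr1 //.
elim/mpolyind: f => [|c m p _ _ [d [f1 [f2 [f3 ->]]]]].
  by exists 0, 0, 0, 0; rewrite !mulr0 mpolyC0 !addr0.
have [->|mn0] := eqVneq m 0%MM.
  exists (c + d), f1, f2, f3.
  by rewrite mpolyX0 mpolyCD -mul_mpolyC mulr1; ring.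
have [i mi] : exists i, (0 < m i)%N.
  apply/existsP; apply/contraR: mn0 => /existsPn mi; apply/eqP/mnmP => i.
  by rewrite mnm0E; have := mi i; lia.
have -> : ('X_[m] : R) = 'X_i * 'X_[m - U_(i)].
  by rewrite -mpolyXD addmC submK //; apply/mnm_lepP => j; rewrite mnm1E; case: eqP => [<-|].
move: 'X_[m - U_(i)] => q.
elim/ord3P: i {mi}.
- by exists d, (c *: q + f1), f2, f3; rewrite -!mul_mpolyC /vx; ring.
- by exists d, f1, (c *: q + f2), f3; rewrite -!mul_mpolyC /vy; ring.
- by exists d, f1, f2, (c *: q + f3); rewrite -!mul_mpolyC /vz; ring.
Qed.

Lemma pihomogXM (i : 'I_3) d (f : R) :
  pihomog mdeg d.+1 ('X_i * f) = 'X_i * pihomog mdeg d f.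
Proof. exact: (pihomog_Mhomog d f (dhomogXU k i)). Qed.

Lemma pihomog_const (p : R) : pihomog mdeg 0 p = (p@_0%MM)%:MP.
Proof.
apply/mpolyP => m; have [->|mn0] := eqVneq m 0%MM.
  rewrite mcoeffC eqxx mulr1.
  have [p1 [p2 [p3 {1}->]]] := const_xyz p.
  rewrite !raddfD /= !(pihomog_Mhomog0 _ (dhomogXU _ _)) // !mcoeff0 !addr0.
  rewrite pihomog_dE ?mcoeffC ?eqxx ?mulr1 //.
  by rewrite -[_%:MP]mulr1 mul_mpolyC; apply/rpredZ/dhomog1.
rewrite mcoeffC (negbTE mn0) mulr0 (dhomog_nemf_coeff (pihomogP _ _ _)) //=.
by rewrite mdeg_eq0.
Qed.

Lemma linear_form (f : R) : f \is 1.-homog ->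
  exists c1 c2 c3, f = c1%:MP * x + c2%:MP * y + c3%:MP * z.
Proof.
move=> hf; have [f1 [f2 [f3 E]]] := const_xyz f.
have h0 : f@_0%MM = 0 by rewrite (dhomog_nemf_coeff hf) //= mdeg0.
exists f1@_0%MM, f2@_0%MM, f3@_0%MM.
rewrite -(pihomog_dE hf) {1}E h0 mpolyC0 add0r !raddfD /= !pihomogXM !pihomog_const; rewrite /vx /vy /vz; ring.
Qed.

Lemma in_maxideal_mul r c s (M : 'M[R]_(r, c)) (w : 'M[R]_(c, s)) :
  in_maxideal M -> in_maxideal (M *m w).
Proof.
move=> hM i j; rewrite mxE raddf_sum big1 //= => l _.
by rewrite mcoeff00M hM mul0r.
Qed.

Section Presentation.
Variables (r1 r2 : nat) (a : 'I_r1 -> nat) (b : 'I_r2 -> nat).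
Variables (d1 : 'rV[R]_r1) (d2 : 'M[R]_(r1, r2)).
Hypothesis d1_graded : graded_map (fun _ => 0%N) a d1.
Hypothesis d2_graded : graded_map a b d2.
Hypothesis d1_max : in_maxideal d1.
Hypothesis d2_max : in_maxideal d2.
Hypothesis d12_exact : exact_at d1 d2.
Hypothesis d2_linear : forall i j, d2 i j \is 1.-homog.

Let ecol i : 'cV[R]_r1 := delta_mx i 0.

(** Otherwise a basis vector would be a syzygy with a unit entry, against minimality. *)
Lemma gen_neq0 i : d1 0 i != 0.
Proof.
apply/eqP => di0; have : d1 *m ecol i = 0.
  by rewrite -colE; apply/matrixP => u v; rewrite !ord1 !mxE.
move/d12_exact => [w /matrixP/(_ i 0)] E.
have := in_maxideal_mul w d2_max i 0; rewrite -E mxE !eqxx mcoeff1 eqxx.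
by move/eqP; rewrite oner_eq0.
Qed.

Lemma pres_complex : d1 *m d2 = 0.
Proof.
apply/matrixP => s l; have : d1 *m (d2 *m delta_mx l (0 : 'I_1)) = 0 by apply/d12_exact; eexists.
by rewrite mulmxA -colE => /matrixP/(_ 0 0); rewrite !ord1 !mxE.
Qed.

Lemma gen_homog i : d1 0 i \is (a i).-homog.
Proof. by case: (d1_graded 0 i) => [->|[_]]; rewrite ?rpred0 ?subn0. Qed.

Lemma syzygy_degree i l : d2 i l != 0 -> b l = (a i).+1.
Proof.
move=> nz; have [/eqP|[le h]] := d2_graded i l; first by rewrite (negbTE nz).
by have := dhomog_uniq nz h (d2_linear i l); lia.
Qed.

(* A column of a linear [d2] only involves generators of one degree, so the
   part of a Koszul syzygy supported in one degree is again a syzygy. *)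
Lemma gen_degree i j : a i = a j.
Proof.
apply/eqP/negPn/negP => aij.
pose v : 'cV[R]_r1 := d1 0 j *: ecol i - d1 0 i *: ecol j.
have : d1 *m v = 0.
  rewrite mulmxBr -!scalemxAr -?colE; apply/matrixP => u t; rewrite !ord1 !mxE mulrC subrr //.
move/d12_exact => [w vE].
pose w' : 'cV[R]_r2 := \col_l (if b l == (a i).+1 then w l 0 else 0).
have v'E : d1 0 j *: ecol i = d2 *m w'.
  apply/matrixP => t u; rewrite !ord1 !mxE.
  transitivity (if a t == a i then v t 0 else 0).
    rewrite !mxE !eqxx !andbT; have [->|ti] := eqVneq t i.
      rewrite !eqxx; have [ij|_] := eqVneq i j; first by rewrite ij eqxx in aij.
      by rewrite mulr0 subr0.
    rewrite mulr0 sub0r; have [->|tj] := eqVneq t j; last by rewrite mulr0 oppr0 if_same.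
    by rewrite eq_sym (negbTE aij).
  case: eqP => ati; last first.
    rewrite big1 // => l _; rewrite mxE; case: eqP => bl; last by rewrite mulr0.
    have [->|/syzygy_degree E] := eqVneq (d2 t l) 0; first by rewrite mul0r.
    by case: ati; lia.
  rewrite vE mxE; apply: eq_bigr => l _; rewrite mxE; case: eqP => // bl.
  have [->|/syzygy_degree E] := eqVneq (d2 t l) 0; first by rewrite !mul0r.
  by case: bl; lia.
have : d1 *m (d2 *m w') = 0 by apply/d12_exact; exists w'.
rewrite -v'E -scalemxAr -colE => /matrixP/(_ 0 0) /eqP.
by rewrite !mxE mulf_eq0 !(negbTE (gen_neq0 _)).
Qed.

Variables (phi : R -> k) (D : nat).
Hypothesis phi_lin : forall c f g, phi (c *: f + g) = c * phi f + phi g.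
Hypothesis phi_deg : forall m, mdeg m != D -> phi 'X_[m] = 0.
Hypothesis d1_image : image_is d1 (ann phi).

Lemma gen_ann i : ann phi (d1 0 i).
Proof.
apply/d1_image; exists (ecol i); rewrite -colE.
by apply/matrixP => u v; rewrite !ord1 !mxE.
Qed.

Lemma d1_mul_ann (v : 'cV_r1) : ann phi ((d1 *m v) 0 0).
Proof.
rewrite mxE; apply: (ann_sum phi_lin) => i _; apply: annMr; exact: gen_ann.
Qed.

Lemma d1_lift f : ann phi f -> exists v : 'cV_r1, (d1 *m v) 0 0 = f.
Proof. by case/d1_image => v E; exists v; rewrite E mxE eqxx. Qed.

(** Such a generator would be redundant: subtracting lifts of f1, f2, f3, times the variables, from
    its basis vector gives a syzygy with constant term 1. *)
Lemma gen_not_max i f1 f2 f3 :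
  ann phi f1 -> ann phi f2 -> ann phi f3 -> d1 0 i <> x * f1 + y * f2 + z * f3.
Proof.
move=> /d1_lift[v1 e1] /d1_lift[v2 e2] /d1_lift[v3 e3] E.
have : d1 *m (ecol i - (x *: v1 + y *: v2 + z *: v3)) = 0.
  apply/matrixP => s t; rewrite !ord1 mulmxBr !mulmxDr -!scalemxAr -colE.
  move: (d1 *m v1) (d1 *m v2) (d1 *m v3) e1 e2 e3 => p1 p2 p3 e1 e2 e3.
  by rewrite !mxE E e1 e2 e3 subrr.
move/d12_exact => [w /matrixP/(_ i 0)] E'.
have := in_maxideal_mul w d2_max i 0; rewrite -E' !mxE !eqxx !mcoeffB !mcoeffD.
rewrite !mcoeff00M !mcoeff00X !mul0r !addr0 subr0 mcoeff1 eqxx.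
by move/eqP; rewrite oner_eq0.
Qed.

Lemma gen_degree_gt0 i : (0 < a i)%N.
Proof.
rewrite lt0n; apply/eqP => ai0; have := gen_homog i; rewrite ai0 => h.
case/eqP: (gen_neq0 i); apply/mpolyP => m; rewrite mcoeff0.
have [->|m0] := eqVneq m 0%MM; first exact: d1_max.
by rewrite (dhomog_nemf_coeff h) //= mdeg_eq0.
Qed.

Lemma syzygy_linear_parts : exists D1 D2 D3 : 'M[k]_(r1, r2),
  d2 = x *: cmx D1 + y *: cmx D2 + z *: cmx D3.
Proof.
have /fin_all_exists[c1 H1] : forall p : 'I_r1 * 'I_r2, exists c1 : k, exists c2 c3 : k,
    d2 p.1 p.2 = c1%:MP * x + c2%:MP * y + c3%:MP * z.
  by move=> p; have [c1 [c2 [c3 E]]] := linear_form (d2_linear p.1 p.2); exists c1, c2, c3.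
have /fin_all_exists[c2 H2] := H1.
have /fin_all_exists[c3 H3] := H2.
exists (\matrix_(i, j) c1 (i, j)), (\matrix_(i, j) c2 (i, j)), (\matrix_(i, j) c3 (i, j)).
by apply/matrixP => i j; rewrite (H3 (i, j)) !mxE; ring.
Qed.

Lemma koszul1_col m (v1 v2 v3 : 'cV[R]_m) : x *: v1 + y *: v2 + z *: v3 = 0 ->
  exists u1 u2 u3 : 'cV[R]_m, [/\ v1 = y *: u3 - z *: u2, v2 = z *: u1 - x *: u3 &
    v3 = x *: u2 - y *: u1].
Proof.
move=> /matrixP E.
have /fin_all_exists[u1 H1] : forall i : 'I_m, exists u1 u2 u3 : R,
    [/\ v1 i 0 = y * u3 - z * u2, v2 i 0 = z * u1 - x * u3 & v3 i 0 = x * u2 - y * u1].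
  by move=> i; apply: koszul1; have := E i 0; rewrite !mxE.
have /fin_all_exists[u2 H2] := H1.
have /fin_all_exists[u3 H3] := H2.
exists (\col_i u1 i), (\col_i u2 i), (\col_i u3 i).
by split; apply/colP => i; have [] := H3 i; rewrite !mxE.
Qed.

(* The pairing of a first Koszul class [f] with a second Koszul class [c] of
   [R / ann phi], evaluated by [phi]: it is nondegenerate, but when [d2] is linear
   all second classes have degree [a i + 1], which fixes the socle degree. *)
Lemma socle_degree i : D = (a i).-1.*2.
Proof.
apply/eqP/negPn/negP => neqD; set e := (a i).-1 in neqD.
have ae : a i = e.+1 by rewrite /e prednK // gen_degree_gt0.
have [f1 [f2 [f3 [gE hf1 hf2 hf3]]]] : exists f1 f2 f3,
    [/\ d1 0 i = x * f1 + y * f2 + z * f3, f1 \is e.-homog, f2 \is e.-homog & f3 \is e.-homog].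
  have [f1 [f2 [f3 E]]] := const_xyz (d1 0 i).
  exists (pihomog mdeg e f1), (pihomog mdeg e f2), (pihomog mdeg e f3).
  split; rewrite ?pihomogP // -[LHS](pihomog_dE (gen_homog i)) ae {1}E d1_max.
  by rewrite mpolyC0 add0r !raddfD /= !pihomogXM.
(* If (f1, f2, f3) could be moved by a Koszul boundary into the annihilator, the generator would be
   redundant. So it suffices to show that it is orthogonal to every second class c. *)
have [|h hE] := @fredholm_ann k 3 phi D phi_lin phi_deg 3 3 curl_mx (row3 f1 f2 f3); last first.
  have [h0 h1 h2] := mul_curlE h.
  have A0 := hE 0; have A1 := hE 1; have A2 := hE 2.
  rewrite mxE [X in _ + X]mxE h0 [X in X - _]mxE /= in A0.
  rewrite mxE [X in _ + X]mxE h1 [X in X - _]mxE /= in A1.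
  rewrite mxE [X in _ + X]mxE h2 [X in X - _]mxE /= in A2.
  by apply: (@gen_not_max i _ _ _ A0 A1 A2); rewrite gE; ring.
move=> c Ec; have [c0 c1 c2] := curl_mulE c.
have := Ec 0; have := Ec 1; have := Ec 2; rewrite c0 c1 c2 => {c0 c1 c2 Ec}.
rewrite row3_mul; move: (c 0 0) (c 1 0) (c 2 0) => {}c1 c2 c3.
move=> /d1_lift[v3 e3] /d1_lift[v2 e2] /d1_lift[v1 e1].
have [D1 [D2 [D3 d2E]]] := syzygy_linear_parts.
pose pr (v : 'cV[R]_r1) := (d1 *m v) 0 0.
have prD u v : pr (u + v) = pr u + pr v by rewrite /pr mulmxDr mxE.
have prZ t v : pr (t *: v) = t * pr v by rewrite /pr -scalemxAr mxE.
have prB u v : pr (u - v) = pr u - pr v by rewrite -scaleN1r prD prZ mulN1r.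
have pr0 v : pr v = 0 -> d1 *m v = 0 by move=> E; apply/matrixP => s t; rewrite !ord1 [RHS]mxE.
rewrite -/(pr v1) -/(pr v2) -/(pr v3) in e1 e2 e3.
(* The curl of c is orthogonal to (x, y, z), so the lifts of its entries combine to a syzygy. *)
have /pr0/d12_exact[w Ew] : pr (x *: v1 + y *: v2 + z *: v3) = 0.
  by rewrite !prD !prZ e1 e2 e3; ring.
have [|u1 [u2 [u3 [E1 E2 E3]]]] :=
    @koszul1_col _ (v1 - cmx D1 *m w) (v2 - cmx D2 *m w) (v3 - cmx D3 *m w).
  have : x *: v1 + y *: v2 + z *: v3 =
      x *: (cmx D1 *m w) + y *: (cmx D2 *m w) + z *: (cmx D3 *m w).
    by rewrite Ew d2E !mulmxDl -!scalemxAl.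
  move: (cmx D1 *m w) (cmx D2 *m w) (cmx D3 *m w) => p1 p2 p3 /colP Ep.
  apply/colP => j; have := Ep j; rewrite !mxE => /eqP; rewrite -subr_eq0 => /eqP <-; ring.
(* The rows d1 D1, d1 D2, d1 D3 satisfy a Koszul relation, hence are a curl. They have degree e + 1
   because all generators have equal degree, so the potentials can be cut down to degree e. *)
have /koszul1_col[q1 [q2 [q3 [Q1 Q2 Q3]]]] :
    x *: (d1 *m cmx D1)^T + y *: (d1 *m cmx D2)^T + z *: (d1 *m cmx D3)^T = 0.
  have := pres_complex; rewrite d2E !mulmxDr -!scalemxAr => /rowP E.
  apply/colP => l; have := E l; move: (d1 *m cmx D1) (d1 *m cmx D2) (d1 *m cmx D3).
  by move=> p1 p2 p3; rewrite !mxE.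
pose H (q : 'cV[R]_r2) l := pihomog mdeg e (q l 0).
have hD (Ds : 'M[k]_(r1, r2)) l : (d1 *m cmx Ds) 0 l \is e.+1.-homog.
  rewrite mxE rpred_sum // => j _; rewrite mxE mulrC mul_mpolyC rpredZ //.
  by rewrite -ae (gen_degree i j) gen_homog.
have {}Q1 l : (d1 *m cmx D1) 0 l = y * H q3 l - z * H q2 l.
  rewrite -[LHS](pihomog_dE (hD _ _)) -[in LHS](trmxK (_ *m _)) mxE Q1 !mxE.
  by rewrite raddfB /= !pihomogXM.
have {}Q2 l : (d1 *m cmx D2) 0 l = z * H q1 l - x * H q3 l.
  rewrite -[LHS](pihomog_dE (hD _ _)) -[in LHS](trmxK (_ *m _)) mxE Q2 !mxE.
  by rewrite raddfB /= !pihomogXM.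
have {}Q3 l : (d1 *m cmx D3) 0 l = x * H q2 l - y * H q1 l.
  rewrite -[LHS](pihomog_dE (hD _ _)) -[in LHS](trmxK (_ *m _)) mxE Q3 !mxE.
  by rewrite raddfB /= !pihomogXM.
pose S q := \sum_l H q l * w l 0.
have prDw (Ds : 'M[k]_(r1, r2)) t q t' q' :
    (forall l, (d1 *m cmx Ds) 0 l = t * H q l - t' * H q' l) ->
    pr (cmx Ds *m w) = t * S q - t' * S q'.
  move=> E; rewrite /pr mulmxA mxE /S !mulr_sumr -sumrB; apply: eq_bigr => l _.
  by rewrite E; ring.
have {}E1 : pr v1 = pr (cmx D1 *m w) + (y * pr u3 - z * pr u2).
  by rewrite -!prZ -prB -E1 prB; ring.
have {}E2 : pr v2 = pr (cmx D2 *m w) + (z * pr u1 - x * pr u3).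
  by rewrite -!prZ -prB -E2 prB; ring.
have {}E3 : pr v3 = pr (cmx D3 *m w) + (x * pr u2 - y * pr u1).
  by rewrite -!prZ -prB -E3 prB; ring.
rewrite (prDw _ _ _ _ _ Q1) e1 in E1; rewrite (prDw _ _ _ _ _ Q2) e2 in E2.
rewrite (prDw _ _ _ _ _ Q3) e3 in E3.
(* The subtracted terms have the same curl as c, so the difference is a multiple of (x, y, z). *)
have [|||t [T1 T2 T3]] := @koszul2 k (c1 - pr u1 - S q1) (c2 - pr u2 - S q2) (c3 - pr u3 - S q3).
- apply/eqP; rewrite -subr_eq0; apply/eqP; move/eqP: E1; rewrite -subr_eq0 => /eqP <-; ring.
- apply/eqP; rewrite -subr_eq0; apply/eqP; move/eqP: E2; rewrite -subr_eq0 => /eqP <-; ring.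
- apply/eqP; rewrite -subr_eq0; apply/eqP; move/eqP: E3; rewrite -subr_eq0 => /eqP <-; ring.
have -> : f1 * c1 + f2 * c2 + f3 * c3 = (t * d1 0 i
    + (f1 * pr u1 + f2 * pr u2 + f3 * pr u3)) + (f1 * S q1 + f2 * S q2 + f3 * S q3).
  have -> : c1 = x * t + pr u1 + S q1 by rewrite -T1; ring.
  have -> : c2 = y * t + pr u2 + S q2 by rewrite -T2; ring.
  have -> : c3 = z * t + pr u3 + S q3 by rewrite -T3; ring.
  by rewrite gE; ring.
rewrite (phiD phi_lin) [X in X + _](ann_phi (phi := phi)); last first.
  apply: (annD phi_lin); first by apply: annMl; apply: gen_ann.
  by do ?apply: (annD phi_lin); apply: annMl; apply: d1_mul_ann.
rewrite add0r /S !mulr_sumr -!big_split /= (phi_sum phi_lin) big1 //= => l _.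
(* x F, y F and z F lie in the annihilator, so only the constant term of w counts; and phi F = 0
   because F has degree 2 e, different from D. *)
pose F := f1 * H q1 l + f2 * H q2 l + f3 * H q3 l.
have hF : F \is (e.*2).-homog.
  by rewrite -addnn; do ?apply: rpredD; apply: dhomogM; rewrite ?pihomogP.
have AD (Ds : 'M[k]_(r1, r2)) : ann phi ((d1 *m cmx Ds) 0 l).
  by rewrite mxE; apply: (ann_sum phi_lin) => j _; apply: annMr; apply: gen_ann.
have A1 := AD D1; have A2 := AD D2; have A3 := AD D3; rewrite Q1 in A1; rewrite Q2 in A2.
rewrite Q3 in A3; have Ag := gen_ann i; rewrite gE in Ag.
have AxF : ann phi (x * F).
  have -> : x * F = H q1 l * (x * f1 + y * f2 + z * f3) + f2 * (x * H q2 l - y * H q1 l)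
    - f3 * (z * H q1 l - x * H q3 l) by rewrite /F; ring.
  by apply: (annB phi_lin); [apply: (annD phi_lin)|]; apply: annMl.
have AyF : ann phi (y * F).
  have -> : y * F = H q2 l * (x * f1 + y * f2 + z * f3) + f3 * (y * H q3 l - z * H q2 l)
    - f1 * (x * H q2 l - y * H q1 l) by rewrite /F; ring.
  by apply: (annB phi_lin); [apply: (annD phi_lin)|]; apply: annMl.
have AzF : ann phi (z * F).
  have -> : z * F = H q3 l * (x * f1 + y * f2 + z * f3) + f1 * (z * H q1 l - x * H q3 l)
    - f2 * (y * H q3 l - z * H q2 l) by rewrite /F; ring.
  by apply: (annB phi_lin); [apply: (annD phi_lin)|]; apply: annMl.
have [w1 [w2 [w3 wE]]] := const_xyz (w l 0).
have -> : f1 * (H q1 l * w l 0) + f2 * (H q2 l * w l 0) + f3 * (H q3 l * w l 0) =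
    (w l 0)@_0%MM *: F + (w1 * (x * F) + w2 * (y * F) + w3 * (z * F)).
  by rewrite -mul_mpolyC {1 2 3}wE /F; ring.
rewrite (phiD phi_lin) (phiZ phi_lin) (phi_homog phi_lin phi_deg hF) ?mulr0 ?add0r 1?eq_sym //.
by apply: ann_phi; do ?apply: (annD phi_lin); apply: annMl.
Qed.

End Presentation.

(** Every generator has degree 1 + D / 2, too large to contribute to f. *)
Lemma linearly_presented_ann (phi : R -> k) (D : nat)
    (phi_lin : forall c f g, phi (c *: f + g) = c * phi f + phi g)
    (phi_deg : forall m, mdeg m != D -> phi 'X_[m] = 0) (f : R) d :
  linearly_presented (ann phi) -> ann phi f -> f \is d.-homog -> (d.*2 <= D)%N -> f = 0.
Proof.
move=> [r1 [r2 [a [b [d1 [d2 [[g1 g2 [m1 m2] im ex] lin]]]]]]] Af hf dD.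
have /im[v vE] := Af.
rewrite -(pihomog_dE hf); have -> : f = (d1 *m v) 0 0 by rewrite vE mxE eqxx.
rewrite mxE raddf_sum big1 //= => i _.
have ai := gen_degree_gt0 g1 m1 m2 ex i.
have aD := socle_degree g1 g2 m1 m2 ex lin phi_lin phi_deg im i.
apply: (pihomog_Mhomog0 _ (gen_homog g1 i)); lia.
Qed.

End LinearPresentation.

(** * Monomial bases *)

Section MonomialBasis.
Variable k : fieldType.
Local Notation R := {mpoly k[3]}.
Local Notation x := (vx k).
Local Notation y := (vy k).
Local Notation z := (vz k).

Definition mon3 (a b c : nat) : 'X_{1..3} := (U_(0%R) *+ a + U_(1%R) *+ b + U_(2%R) *+ c)%MM.

Lemma mon3E a b c : ('X_[mon3 a b c] : R) = x ^+ a * y ^+ b * z ^+ c.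
Proof. by rewrite !mpolyXD -!mpolyXn. Qed.

Lemma mon3_exp a b c :
  [/\ mon3 a b c 0 = a, mon3 a b c 1 = b & mon3 a b c 2 = c].
Proof. by split; rewrite !mnmDE !mulmnE !mnm1E /=; lia. Qed.

Lemma mnm3P (m : 'X_{1..3}) : m = mon3 (m 0) (m 1) (m 2).
Proof.
by apply/mnmP; apply: ord3P; have [h0 h1 h2] := mon3_exp (m 0%R) (m 1%R) (m 2%R).
Qed.

Lemma mdeg_mon3 a b c : mdeg (mon3 a b c) = (a + b + c)%N.
Proof. by rewrite !mdegD !mdegMn !mdeg1 !mul1n. Qed.

Definition symU_exps (d : nat) : seq 'X_{1..3} :=
  [seq mon3 a b (d - a - b) | a <- rev (iota 0 d.+1), b <- rev (iota 0 (d - a).+1)].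

Lemma symU_basisE d : symU_basis k d = [seq 'X_[m] | m <- symU_exps d].
Proof.
rewrite /symU_exps map_allpairs; apply: eq_allpairs => a b.
by rewrite mon3E.
Qed.

Lemma mem_symU_exps d m : (m \in symU_exps d) = (mdeg m == d).
Proof.
apply/allpairsPdep/eqP => [[a [b [ha hb ->]]]|dm].
  move: ha hb; rewrite !mem_rev !mem_iota mdeg_mon3; lia.
have := mdeg_mon3 (m 0) (m 1) (m 2); rewrite -mnm3P dm => E.
exists (m 0), (m 1); rewrite !mem_rev !mem_iota; split; [lia|lia|].
by rewrite {1}(mnm3P m); congr mon3; lia.
Qed.

Lemma uniq_symU_exps d : uniq (symU_exps d).
Proof.
apply: allpairs_uniq_dep.
- by rewrite rev_uniq iota_uniq.
- by move=> a _; rewrite rev_uniq iota_uniq.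
move=> [a b] [a' b'] _ _ /= E.
have [e0 e1 _] := mon3_exp a b (d - a - b); have [e0' e1' _] := mon3_exp a' b' (d - a' - b').
by have <- : a = a'; [rewrite -e0 E|have <- : b = b' by rewrite -e1 E].
Qed.

Lemma size_symU_exps d : size (symU_exps d) = Nn d.+1.
Proof.
rewrite size_allpairs_dep sumnE big_map big_rev -/(index_iota 0 d.+1) big_mkord.
rewrite /Nn -bin2_sum big_mkord [RHS]big_ord_recl /= add0n [RHS](reindex_inj rev_ord_inj) /=.
by apply: eq_bigr => i _; rewrite size_rev /= size_iota /bump /=; lia.
Qed.

Definition yz_exps d := [seq mon3 0 b (d - b) | b <- rev (iota 0 d.+1)].

(** Monomials divisible by x come first, so the right-most columns in the theorem belong to the
    monomials in y and z. *)
Lemma symU_exps_cat d : exists s, symU_exps d = s ++ yz_exps d /\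
  forall m, m \in s -> (0 < m 0%R)%N.
Proof.
exists [seq mon3 a b (d - a - b) | a <- rev (iota 1 d), b <- rev (iota 0 (d - a).+1)].
split.
  rewrite /symU_exps [iota 0 d.+1]/= rev_cons -cats1 allpairs_cat; congr (_ ++ _).
  by rewrite /= cats0 /yz_exps subn0.
move=> m /allpairsPdep[a [b [ha _ ->]]]; have [-> _ _] := mon3_exp a b (d - a - b).
by move: ha; rewrite mem_rev mem_iota; lia.
Qed.

Section Index.
Variable d : nat.
Local Notation N := (Nn d.+1).

Definition bexp (l : 'I_N) : 'X_{1..3} := nth 0%MM (symU_exps d) l.

Lemma mbasE (l : 'I_N) : mbas k l = 'X_[bexp l].
Proof.
by rewrite /mbas symU_basisE (nth_map 0%MM) ?size_symU_exps ?ltn_ord.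
Qed.

Lemma bexp_inj : injective bexp.
Proof.
move=> l l' /eqP; rewrite nth_uniq ?uniq_symU_exps ?size_symU_exps ?ltn_ord //.
by move=> /eqP; apply: val_inj.
Qed.

Lemma mdeg_bexp l : mdeg (bexp l) = d.
Proof. by apply/eqP; rewrite -mem_symU_exps mem_nth // size_symU_exps ltn_ord. Qed.

Lemma bexp_onto m : mdeg m = d -> exists l, m = bexp l.
Proof.
move=> /eqP; rewrite -mem_symU_exps => hm.
have lt : (index m (symU_exps d) < N)%N by rewrite -size_symU_exps index_mem.
by exists (Ordinal lt); rewrite /bexp nth_index.
Qed.

(** Position of y^(d-i) z^i, built exactly as the indices inside [rcols] and [brsub]. *)
Definition ridx (i : 'I_d.+1) : 'I_N := Ordinal (rc_lt i (n_le_Nn d.+1)).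

Lemma size_yz_exps : size (yz_exps d) = d.+1.
Proof. by rewrite size_map size_rev size_iota. Qed.

Lemma bexp_ridx i : bexp (ridx i) = mon3 0 (d - i) i.
Proof.
have [s [E _]] := symU_exps_cat d; have lti := ltn_ord i.
have ss : (size s + d.+1 = N)%N by rewrite -size_symU_exps E size_cat size_yz_exps.
rewrite /bexp E nth_cat /= -ss addnK ltnNge leq_addr /= addKn.
rewrite (nth_map 0%N) ?size_rev ?size_iota // nth_rev ?size_iota // nth_iota; last by lia.
by congr mon3; lia.
Qed.

Lemma bexp_x l : (forall i, l != ridx i) -> (0 < bexp l 0%R)%N.
Proof.
have [s [E hs]] := symU_exps_cat d => hl.
have ss : (size s + d.+1 = N)%N by rewrite -size_symU_exps E size_cat size_yz_exps.
have ltl : (l < size s)%N.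
  rewrite ltnNge; apply/negP => le; have lt : (l - size s < d.+1)%N by have := ltn_ord l; lia.
  by case/eqP: (hl (Ordinal lt)); apply: val_inj; move: ss le => /=; lia.
by apply: hs; rewrite /bexp E nth_cat ltl mem_nth.
Qed.

Lemma homog_mbas (f : R) : f \is d.-homog -> f = \sum_l f@_(bexp l) *: mbas k l.
Proof.
move=> hf; apply/mpolyP => m; rewrite raddf_sum /=.
have [dm|dm] := eqVneq (mdeg m) d; last first.
  rewrite (dhomog_nemf_coeff hf) // big1 // => l _; rewrite mbasE mcoeffZ mcoeffX.
  by case: eqP => [E|_]; [rewrite -E mdeg_bexp eqxx in dm | rewrite mulr0].
have [l ->] := bexp_onto dm; rewrite (bigD1 l) //= mbasE mcoeffZ mcoeffX eqxx mulr1.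
rewrite big1 ?addr0 // => l' ll'; rewrite mbasE mcoeffZ mcoeffX (inj_eq bexp_inj).
by rewrite (negbTE ll') mulr0.
Qed.

Lemma mbas_homog (l : 'I_N) : mbas k l \is d.-homog.
Proof. by rewrite mbasE dhomogX /= mdeg_bexp. Qed.

Lemma mcoeff_mbas (l l' : 'I_N) : (mbas k l)@_(bexp l') = (l == l')%:R.
Proof. by rewrite mbasE mcoeffX (inj_eq bexp_inj). Qed.

Lemma mbas_split (c : 'I_N -> k) : exists w,
  \sum_l c l *: mbas k l = \sum_i c (ridx i) *: mbas k (ridx i) + x * w.
Proof.
have /fin_all_exists[q qE] : forall l : 'I_N, exists q,
    mbas k l = (if [exists i, l == ridx i] then mbas k l else 0) + x * q.
  move=> l; case: existsP => [_|H]; first by exists 0; rewrite mulr0 addr0.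
  have lx : (0 < bexp l 0%R)%N.
    by apply: bexp_x => i; apply/negP => li; apply: H; exists i.
  exists 'X_[bexp l - U_(0%R)]; rewrite add0r mbasE -mpolyXD addmC submK //.
  by apply/mnm_lepP => j; rewrite mnm1E; case: eqP => [<-|].
exists (\sum_l c l *: q l).
rewrite (eq_bigr (fun l => c l *:
   (if [exists i, l == ridx i] then mbas k l else 0) + x * (c l *: q l))); last first.
  by move=> l _; rewrite {1}qE scalerDr -scalerAr.
rewrite big_split /= -mulr_sumr; congr (_ + _).
rewrite (eq_bigr (fun l => if [exists i, l == ridx i] then c l *: mbas k l else 0)).
  rewrite -big_mkcond /= (reindex_onto ridx (fun l => inord (l - (N - d.+1)))) /=.
    apply: eq_big => // i; apply/andP; split; first by apply/existsP; exists i.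
    by apply/eqP/val_inj; rewrite /= inordK addKn.
  move=> l /existsP[i /eqP ->]; apply: val_inj.
  by rewrite /= inordK addKn.
by move=> l _; case: ifP => // _; rewrite scaler0.
Qed.

End Index.

Section Functional.
Variables (d : nat) (w : Dform k).

(** Gives polynomials with different supports a common index set, as linearity requires. *)
Lemma DevalwE K u : (msize u <= K)%N ->
  Deval d w u = \sum_(m : 'X_{1..3 < K} | mdeg m == d) u@_m * w m.
Proof.
move=> leK; pose I : subFinType _ := 'X_{1..3 < K}.
rewrite /Deval (ssrcomplements.big_mksub_cond I) //=; first last.
- by move=> m /msize_mdeg_lt /leq_trans /(_ leK) ->.
- by rewrite msupp_uniq.
rewrite -big_filter_cond big_rmcond ?big_filter //=.
by move=> m /memN_msupp_eq0 ->; rewrite mul0r.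
Qed.

Lemma Deval_lin c f g : Deval d w (c *: f + g) = c * Deval d w f + Deval d w g.
Proof.
pose K := maxn (msize (c *: f + g)) (maxn (msize f) (msize g)).
rewrite !(@DevalwE K) ?leq_max ?leqnn ?orbT // mulr_sumr -big_split /=.
by apply: eq_bigr => m _; rewrite mcoeffD mcoeffZ; ring.
Qed.

Lemma DevalX m : Deval d w 'X_[m] = if mdeg m == d then w m else 0.
Proof. by rewrite /Deval msuppX big_mkcond big_seq1 mcoeffX eqxx mul1r. Qed.

End Functional.

Section SocleForm.
Variables (n : nat) (Phi : Dform k).

Definition xPhi (f : R) : k := Deval (2 * n - 1) Phi (x * f).

Lemma xPhi_lin c f g : xPhi (c *: f + g) = c * xPhi f + xPhi g.
Proof. by rewrite /xPhi mulrDr -scalerAr Deval_lin. Qed.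

Lemma xPhi_deg m : (0 < n)%N -> mdeg m != (2 * n - 2)%N -> xPhi 'X_[m] = 0.
Proof.
by move=> n0 dm; rewrite /xPhi -mpolyXD DevalX mdegD mdeg1; case: eqP => // E; lia.
Qed.

Lemma annIE mu : (0 < n)%N -> annI n Phi mu <-> ann xPhi mu.
Proof.
move=> n0.
have E u : Deval (2 * n - 2) (Dact (2 * n - 1) x Phi) u = xPhi u.
  rewrite (mpolyE u) (phi_sum (Deval_lin _ _)) (phi_sum xPhi_lin); apply: eq_bigr => m _.
  rewrite (phiZ (Deval_lin _ _)) (phiZ xPhi_lin) DevalX /Dact /xPhi; congr (_ * _).
  rewrite [x * _]mulrC; case: eqP => // dm; rewrite -mpolyXD DevalX mdegD mdeg1.
  by case: eqP => //; lia.
rewrite (annP xPhi_lin); split=> h m; first by rewrite -E; apply: h.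
by rewrite /annI {1}/Dact E; apply: h.
Qed.

End SocleForm.
End MonomialBasis.

(** * Generators and their linear relations *)

Section Generators.
Variables (k : fieldType) (d : nat) (Phi : Dform k).
Local Notation R := {mpoly k[3]}.
Local Notation x := (vx k).
Local Notation y := (vy k).
Local Notation z := (vz k).
Local Notation n := d.+1.
Local Notation N := (Nn n).
Local Notation phi := (xPhi n Phi).
Local Notation p := (pmat n Phi).
Local Notation I := (ann phi).

Definition lin_fun (lam : R -> k) := forall c f g, lam (c *: f + g) = c * lam f + lam g.

Let phi_lin : lin_fun phi := xPhi_lin n Phi.

Lemma xPhi_degS m : mdeg m != d.*2 -> phi 'X_[m] = 0.
Proof. by move=> dm; apply: xPhi_deg => //; apply: contra dm => /eqP ->; apply/eqP; lia. Qed.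

Lemma ann_homog e f : f \is e.-homog ->
  (forall m, (mdeg m + e)%N = d.*2 -> phi ('X_[m] * f) = 0) -> I f.
Proof.
move=> hf H; apply/(annP phi_lin) => m; have [/H //|ne] := eqVneq (mdeg m + e)%N d.*2.
have hm : ('X_[m] : R) \is (mdeg m).-homog by rewrite dhomogX.
exact: (phi_homog phi_lin xPhi_degS (dhomogM hm hf) ne).
Qed.

Lemma pmatE i j : p i j = phi (mbas k i * mbas k j).
Proof. by rewrite mxE /xPhi mulrA. Qed.

Lemma pmat_sym : p^T = p.
Proof. by apply/matrixP => i j; rewrite mxE !pmatE mulrC. Qed.

Lemma phi_mbas_comb (c : 'rV[k]_N) j :
  phi ((\sum_l c 0 l *: mbas k l) * mbas k j) = (c *m p) 0 j.
Proof.
rewrite mulr_suml (phi_sum phi_lin) mxE; apply: eq_bigr => l _.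
by rewrite -scalerAl (phiZ phi_lin) pmatE.
Qed.

Lemma mbas_comb_homog (c : 'rV[k]_N) : \sum_l c 0 l *: mbas k l \is d.-homog.
Proof. by apply: rpred_sum => l _; apply: rpredZ; apply: mbas_homog. Qed.

Lemma mcoeff_mbas_comb (c : 'rV[k]_N) l : (\sum_l c 0 l *: mbas k l)@_(bexp l) = c 0 l.
Proof.
rewrite raddf_sum /= (bigD1 l) //= mcoeffZ mcoeff_mbas eqxx mulr1 big1 ?addr0 // => j jl.
by rewrite mcoeffZ mcoeff_mbas (negbTE jl) mulr0.
Qed.

(** A row killed by p is the coefficient vector of a form of degree d in I. *)
Lemma pmat_unit : (forall f, I f -> f \is d.-homog -> f = 0) -> p \in unitmx.
Proof.
move=> H; rewrite -row_free_unit; apply: inj_row_free => c cp.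
have f0 : \sum_l c 0 l *: mbas k l = 0.
  apply: H (mbas_comb_homog c); apply: (ann_homog (mbas_comb_homog c)) => m dm.
  have [j ->] : exists j, m = @bexp d j by apply: bexp_onto; lia.
  by rewrite mulrC -mbasE phi_mbas_comb cp mxE.
by apply/rowP => l; rewrite -(mcoeff_mbas_comb c l) f0 mcoeff0 mxE.
Qed.

Hypothesis p_unit : p \in unitmx.
Local Notation pinv := (invmx p).

Lemma pinv_sym i j : pinv i j = pinv j i.
Proof. by rewrite -{1}pmat_sym -trmx_inv mxE. Qed.

Lemma pairing_inj f : f \is d.-homog -> (forall l : 'I_N, phi (f * mbas k l) = 0) -> f = 0.
Proof.
move=> hf H; pose c : 'rV[k]_N := \row_l f@_(bexp l).
have fE : f = \sum_l c 0 l *: mbas k l.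
  by rewrite {1}(homog_mbas hf); apply: eq_bigr => l _; rewrite mxE.
have c0 : c *m p = 0 by apply/rowP => j; rewrite -phi_mbas_comb -fE H mxE.
rewrite fE big1 // => l _; rewrite -[c](mulmxK p_unit) c0 mul0mx mxE scale0r //.
Qed.

(** A power of x, which is not a zero divisor, brings f to degree d, where the pairing is
    perfect. *)
Lemma ann_low e f : f \is e.-homog -> (e <= d)%N -> I f -> f = 0.
Proof.
move=> hf ed If; have hx : x ^+ (d - e) \is (1 * (d - e)).-homog by rewrite dhomogMn ?vx_homog.
have /eqP : x ^+ (d - e) * f = 0.
  apply: pairing_inj; first by have := dhomogM hx hf; rewrite mul1n subnK.
  by move=> l; apply: ann_phi; apply: annMr; apply: annMl.
by rewrite mulf_eq0 expf_eq0 (negbTE (mpolyX_neq0 _ _)) andbF => /eqP.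
Qed.

(* [phi] is a perfect pairing on forms of degree [d]: [rep lam] is the form that
   represents the functional [lam].  In the notation of the theorem, [W] and [u]
   collect the last columns of [p^-1] and the columns of [p^-1 r]. *)
Section Representative.
Variable lam : R -> k.
Hypothesis lam_lin : lin_fun lam.

Definition repc : 'rV[k]_N := (\row_l lam (mbas k l)) *m pinv.
Definition rep : R := \sum_l repc 0 l *: mbas k l.

Lemma rep_homog : rep \is d.-homog. Proof. exact: mbas_comb_homog. Qed.

Lemma phi_rep f : f \is d.-homog -> phi (rep * f) = lam f.
Proof.
move=> hf; rewrite (homog_mbas hf) mulr_sumr (phi_sum phi_lin) (phi_sum lam_lin).
apply: eq_bigr => l _; rewrite -scalerAr (phiZ phi_lin) (phiZ lam_lin) phi_mbas_comb.
by rewrite mulmxKV // mxE.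
Qed.

Lemma rep_split : exists w, rep = \sum_i repc 0 (ridx i) *: mbas k (ridx i) + x * w.
Proof. exact: mbas_split. Qed.

End Representative.

Definition mu (i : 'I_n) : R := mbas k (ridx i).
(** Dual to [mu]: pairing with [W i] reads off the coefficient of [mu i]. *)
Definition W (i : 'I_n) : R := rep (fun f => f@_(bexp (ridx i))).
Definition psi (j : 'I_n.+1) (f : R) : k := Deval (2 * n - 1) Phi (m0bas k j * f).
Definition u (j : 'I_n.+1) : R := rep (psi j).
(** A monomial in y and z corrected by a multiple of x into I: [u j] satisfies phi (u_j x m) = phi
    (m0_j m) for m of degree d - 1. *)
Definition g2 (j : 'I_n.+1) : R := m0bas k j - x * u j.
(** Deleting the first or the last row or column is reindexing along [up] or [dn]; on monomials this
    is multiplication by z or y ([z_mu], [y_mu]). *)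
Definition up (l : 'I_n) : 'I_n.+1 := lift ord0 l.
Definition dn (l : 'I_n) : 'I_n.+1 := lift ord_max l.

Lemma mcoeff_lin m : lin_fun (fun f : R => f@_m).
Proof. by move=> c f g; rewrite mcoeffD mcoeffZ. Qed.

Lemma psi_lin j : lin_fun (psi j).
Proof. by move=> c f g; rewrite /psi mulrDr -scalerAr Deval_lin. Qed.

Lemma psi_x j f : psi j (x * f) = phi (m0bas k j * f).
Proof. by rewrite /psi /xPhi mulrCA. Qed.

Lemma muE l : mu l = y ^+ (d - l) * z ^+ l.
Proof. by rewrite /mu mbasE bexp_ridx mon3E expr0 mul1r. Qed.

Lemma dnE l : dn l = l :> nat.
Proof. by rewrite /dn /= /bump leqNgt ltn_ord. Qed.

Lemma z_mu l : z * mu l = m0bas k (up l).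
Proof. by rewrite muE /m0bas /= /bump add1n subSS exprS mulrCA. Qed.

Lemma y_mu l : y * mu l = m0bas k (dn l).
Proof.
rewrite muE /m0bas dnE subSn; last by rewrite -ltnS.
by rewrite exprS mulrA.
Qed.

Lemma m0bas_homog (j : 'I_n.+1) : m0bas k j \is n.-homog.
Proof.
have h : y ^+ (n - j) * z ^+ j \is (1 * (n - j) + 1 * j).-homog.
  by apply: dhomogM; apply: dhomogMn; apply: dhomogXU.
by move: h; rewrite !mul1n subnK // -ltnS.
Qed.

Lemma mu_homog l : mu l \is d.-homog. Proof. exact: mbas_homog. Qed.
Lemma W_homog l : W l \is d.-homog. Proof. exact: rep_homog. Qed.
Lemma u_homog j : u j \is d.-homog. Proof. exact: rep_homog. Qed.

Lemma xM_homog e (f : R) : f \is e.-homog -> x * f \is e.+1.-homog.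
Proof. by move=> hf; apply: (dhomogM (vx_homog k) hf). Qed.

Lemma g2_homog j : g2 j \is n.-homog.
Proof. by rewrite rpredB ?m0bas_homog // xM_homog ?u_homog. Qed.

Lemma xW_homog l : x * W l \is n.-homog.
Proof. by rewrite xM_homog ?W_homog. Qed.

Lemma phi_W l f : f \is d.-homog -> phi (W l * f) = f@_(bexp (ridx l)).
Proof. by move=> hf; rewrite (phi_rep (mcoeff_lin _)). Qed.

Lemma phi_u j f : f \is d.-homog -> phi (u j * f) = psi j f.
Proof. by move=> hf; rewrite (phi_rep (psi_lin _)). Qed.

(** Both sides are lam on the basis paired with one column of p^-1, by the symmetry of p^-1. *)
Lemma repc_W lam l : lin_fun lam -> repc lam 0 (ridx l) = lam (W l).
Proof.
move=> lam_lin; rewrite /W /rep (phi_sum lam_lin) mxE; apply: eq_bigr => j _.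
rewrite (phiZ lam_lin) !mxE mulrC; congr (_ * _); rewrite pinv_sym.
rewrite (bigD1 (ridx l)) //= big1 ?addr0 => [|i il]; rewrite mxE mcoeff_mbas ?eqxx ?mul1r //.
by rewrite (negbTE il) mul0r.
Qed.

Lemma mcoeff_xM (m : 'X_{1..3}) (f : R) : m 0%R = 0%N -> (x * f)@_m = 0.
Proof.
move=> m0; rewrite (mpolyE f) mulr_sumr raddf_sum big1 //= => m' _.
rewrite -scalerAr mcoeffZ -mpolyXD mcoeffX; case: eqP => [E|_]; last by rewrite mulr0.
by move: m0; rewrite -E mnmDE mnm1E.
Qed.

(** phi (m x W_l) is the coefficient of [mu l] in x m, and [mu l] is free of x. *)
Lemma xW_ann l : I (x * W l).
Proof.
apply: (ann_homog (xW_homog l)) => m dm.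
have hm : x * 'X_[m] \is d.-homog.
  by rewrite -mpolyXD dhomogX /= mdegD mdeg1; lia.
rewrite mulrCA mulrA [X in phi X]mulrC phi_W // mcoeff_xM // bexp_ridx.
by have [] := mon3_exp 0 (d - l) l.
Qed.

Lemma g2_ann j : I (g2 j).
Proof.
apply: (ann_homog (g2_homog j)) => m dm.
have hm : x * 'X_[m] \is d.-homog.
  by rewrite -mpolyXD dhomogX /= mdegD mdeg1; lia.
rewrite mulrBr (phiB phi_lin); have -> : 'X_[m] * (x * u j) = u j * (x * 'X_[m]) by ring.
by rewrite phi_u // psi_x mulrC subrr.
Qed.

Lemma homog_xM e (f : R) : x * f \is e.+1.-homog -> f \is e.-homog.
Proof.
move=> hf; rewrite homog_piE; apply/eqP; apply: mulx_inj.
by rewrite -[RHS](pihomog_dE hf) pihomogXM.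
Qed.

Lemma psi_mu_up l t : psi (up t) (mu l) = psi (up l) (mu t).
Proof. by rewrite /psi -!z_mu; congr (Deval _ _ _); ring. Qed.

Lemma psi_mu_dn l t : psi (dn t) (mu l) = psi (dn l) (mu t).
Proof. by rewrite /psi -!y_mu; congr (Deval _ _ _); ring. Qed.

Lemma sum_phi_W_mu (c : 'I_n -> k) t : \sum_i phi (c i *: W i * mu t) = c t.
Proof.
rewrite (bigD1 t) //= big1 ?addr0 => [|i it]; rewrite -scalerAl (phiZ phi_lin).
  by rewrite (phi_W _ (mu_homog t)) mcoeff_mbas eqxx mulr1.
rewrite (phi_W _ (mu_homog t)) mcoeff_mbas; case: eqP => [E|_]; last by rewrite mulr0.
by case/eqP: it; apply: val_inj; move: (congr1 val E) => /=; lia.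
Qed.

Local Opaque rep W u mu psi xPhi.

Section KeyRelation.
Variables lam lam' : R -> k.
Hypotheses (lam_lin : lin_fun lam) (lam'_lin : lin_fun lam').
Hypothesis lam_zy : forall f, lam (z * f) = lam' (y * f).

(* Modulo [x] this is the relation between the [y^b z^c]; the difference is
   [x * H] with [H] of degree [d], so it vanishes once [phi (H * m) = 0] for
   every monomial [m] of degree [d]. *)
Lemma key_relation : z * rep lam - y * rep lam' =
  \sum_l lam (W l) *: g2 (up l) - \sum_l lam' (W l) *: g2 (dn l)
  + \sum_l (lam (u (up l)) - lam' (u (dn l))) *: (x * W l).
Proof.
have [w wE] := rep_split lam; have [w' w'E] := rep_split lam'.
have eW : \sum_i repc lam 0 (ridx i) *: mbas k (ridx i) = \sum_i lam (W i) *: mu i.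
  by apply: eq_bigr => i _; rewrite repc_W.
have eW' : \sum_i repc lam' 0 (ridx i) *: mbas k (ridx i) = \sum_i lam' (W i) *: mu i.
  by apply: eq_bigr => i _; rewrite repc_W.
rewrite eW in wE; rewrite eW' in w'E => {eW eW'}.
set rhs := (X in _ = X).
pose H := z * w - y * w' + (\sum_l lam (W l) *: u (up l) - \sum_l lam' (W l) *: u (dn l))
  - \sum_l (lam (u (up l)) - lam' (u (dn l))) *: W l.
have HE : z * rep lam - y * rep lam' - rhs = x * H.
  have -> : rhs = \sum_l lam (W l) *: g2 (up l) - \sum_l lam' (W l) *: g2 (dn l)
      + x * \sum_l (lam (u (up l)) - lam' (u (dn l))) *: W l.
    by rewrite mulr_sumr /rhs; congr (_ + _); apply: eq_bigr => l _; rewrite scalerAr.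
  rewrite wE w'E /H ![_ * (\sum_i _ + _)]mulrDr [z * _]mulr_sumr [y * _]mulr_sumr.
  have -> : \sum_i z * (lam (W i) *: mu i) = \sum_l lam (W l) *: g2 (up l)
       + x * \sum_l lam (W l) *: u (up l).
    rewrite mulr_sumr -big_split; apply: eq_bigr => l _ /=.
    by rewrite /g2 -z_mu -!mul_mpolyC; ring.
  have -> : \sum_i y * (lam' (W i) *: mu i) = \sum_l lam' (W l) *: g2 (dn l)
       + x * \sum_l lam' (W l) *: u (dn l).
    rewrite mulr_sumr -big_split; apply: eq_bigr => l _ /=.
    by rewrite /g2 -y_mu -!mul_mpolyC; ring.
  by ring.
have hH : H \is d.-homog.
  apply: homog_xM; rewrite -HE; apply: rpredB; last first.
    apply: rpredD; last by apply: rpred_sum => l _; rewrite rpredZ ?xW_homog.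
    by apply: rpredB; apply: rpred_sum => l _; rewrite rpredZ ?g2_homog.
  by apply: rpredB; apply: (dhomogM (dhomogXU _ _)); apply: rep_homog.
have IR : I rhs.
  apply: (annD phi_lin); last by apply: (ann_sum phi_lin) => l _; apply: annZ; apply: xW_ann.
  by apply: (annB phi_lin); apply: (ann_sum phi_lin) => l _; apply: annZ; apply: g2_ann.
suff H0 : H = 0 by apply/eqP; rewrite -subr_eq0 HE H0 mulr0.
apply: (pairing_inj hH) => l; have [/existsP[t /eqP ->]|/existsPn lx] := boolP [exists t, l == ridx t].
  (* On mu_t: the splittings of the representatives give x w and x w', the symmetry of the pairing
     gives psi (rep lam) = lam u, and all terms cancel. *)
  rewrite -/(mu t) /H mulrBl mulrDl !mulrBl !mulr_suml.
  rewrite (phiB phi_lin) (phiD phi_lin) !(phiB phi_lin) !(phi_sum phi_lin).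
  have wz : z * w * mu t = m0bas k (up t) * w by rewrite -z_mu; ring.
  have wy : y * w' * mu t = m0bas k (dn t) * w' by rewrite -y_mu; ring.
  rewrite wz wy -!psi_x.
  have -> : x * w = rep lam - \sum_i lam (W i) *: mu i by rewrite wE; ring.
  have -> : x * w' = rep lam' - \sum_i lam' (W i) *: mu i by rewrite w'E; ring.
  have ru : psi (up t) (rep lam) = lam (u (up t)).
    by rewrite -phi_u ?rep_homog // mulrC phi_rep ?u_homog.
  have rd : psi (dn t) (rep lam') = lam' (u (dn t)).
    by rewrite -phi_u ?rep_homog // mulrC phi_rep ?u_homog.
  rewrite !(phiB (psi_lin _)) ru rd !(phi_sum (psi_lin _)).
  have -> : \sum_i psi (up t) (lam (W i) *: mu i) = \sum_i phi (lam (W i) *: u (up i) * mu t).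
    apply: eq_bigr => i _; rewrite (phiZ (psi_lin _)) -scalerAl (phiZ phi_lin).
    by rewrite phi_u ?mu_homog // psi_mu_up.
  have -> : \sum_i psi (dn t) (lam' (W i) *: mu i) = \sum_i phi (lam' (W i) *: u (dn i) * mu t).
    apply: eq_bigr => i _; rewrite (phiZ (psi_lin _)) -scalerAl (phiZ phi_lin).
    by rewrite phi_u ?mu_homog // psi_mu_dn.
  rewrite [X in _ - X](sum_phi_W_mu (fun i => lam (u (up i)) - lam' (u (dn i)))).
  have cancel (a b s s' : k) : a - s - (b - s') + (s - s') - (a - b) = 0 by ring.
  exact: cancel.
(* On a monomial x m': x H is the left side minus an element of I, so phi sees only lam (z m') -
   lam' (y m') = 0. *)
have [m' mE] : exists m', bexp l = (U_(0%R) + m')%MM.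
  exists (bexp l - U_(0%R))%MM; rewrite addmC submK //.
  by apply/mnm_lepP => j; rewrite mnm1E; case: eqP => // <-; apply: bexp_x.
rewrite mbasE mE mpolyXD -/x mulrA [H * x]mulrC -HE mulrBl (phiB phi_lin).
rewrite [X in _ - X](ann_phi (annMr _ IR)) subr0 mulrBl (phiB phi_lin).
have dm : (mdeg m').+1 = d by rewrite -(mdeg_bexp l) mE mdegD mdeg1.
have hm : ('X_[m'] : R) \is (mdeg m').-homog by rewrite dhomogX.
have hz : z * 'X_[m'] \is d.-homog by rewrite -dm; apply: (dhomogM (vz_homog k) hm).
have hy : y * 'X_[m'] \is d.-homog by rewrite -dm; apply: (dhomogM (vy_homog k) hm).
by rewrite ![_ * rep _]mulrC -!mulrA !phi_rep // lam_zy subrr.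
Qed.

End KeyRelation.

End Generators.

Lemma sum_lift (V : nmodType) m (h : 'I_m.+1) (F : 'I_m.+1 -> V) :
  \sum_j F j = F h + \sum_l F (lift h l).
Proof.
rewrite (bigD1 h) //=; congr (_ + _).
rewrite (eq_bigl (fun j => unlift h j != None)) => [|j]; last first.
  by case: unliftP => [l ->|->]; rewrite ?eqxx // eq_sym neq_lift.
case: m h F => [|m] h F.
  rewrite big_ord0 big1 // => j; case: unliftP => // -[] //.
rewrite (reindex_onto (lift h) (fun j => odflt ord0 (unlift h j))) => [|j].
  by apply: eq_bigl => l; rewrite liftK eqxx.
by case: unliftP => // l -> _; rewrite liftK.
Qed.

Section UnliftMatrix.
Variables (V : nmodType) (r m : nat) (M : 'M[V]_(r, m)).

(** Zero padding becomes the default value at the index missed by [lift], the form in which boundary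
    terms drop out of sums. *)
Lemma row_mx0lE i (j : 'I_m.+1) :
  (row_mx (0 : 'M_(r, 1)) M : 'M_(r, m.+1)) i j = oapp (M i) 0 (unlift ord0 j).
Proof.
rewrite mxE; case: splitP => [j'|l] E.
  by rewrite mxE; case: unliftP => [l jE|_] //; move: E; rewrite jE ord1.
have -> : j = lift ord0 l by apply: val_inj; exact: E.
by rewrite liftK.
Qed.

Lemma row_mx0rE i (j : 'I_m.+1) :
  (castmx (erefl r, addn1 m) (row_mx M (0 : 'M_(r, 1)))) i j =
  oapp (M i) 0 (unlift ord_max j).
Proof.
rewrite castmxE cast_ord_id mxE; case: splitP => [l|j'] E.
  have -> : j = lift ord_max l by apply: val_inj; move: E; rewrite /= /bump [(m <= l)%N]leqNgt ltn_ord.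
  by rewrite liftK.
rewrite mxE; case: unliftP => [l jE|_] //; move: E; rewrite jE /= /bump; have := ltn_ord l.
by move=> /= ltl E; exfalso; lia.
Qed.

End UnliftMatrix.

Lemma sum_unlift (T : pzRingType) m (h : 'I_m.+1) (c : 'I_m -> T) (g : 'I_m.+1 -> T) :
  \sum_j oapp c 0 (unlift h j) * g j = \sum_l c l * g (lift h l).
Proof.
rewrite (sum_lift h) unlift_none mul0r add0r; apply: eq_bigr => l _.
by rewrite liftK.
Qed.

Lemma sum_unliftC (k : fieldType) r m (h : 'I_m.+1) (c : 'I_m -> k) (g : 'I_m.+1 -> {mpoly k[r]}) :
  \sum_j (oapp c 0 (unlift h j))%:MP * g j = \sum_l c l *: g (lift h l).
Proof.
rewrite (sum_lift h) unlift_none mpolyC0 mul0r add0r; apply: eq_bigr => l _.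
by rewrite liftK mul_mpolyC.
Qed.

(** * The relations [b2 *m gen = 0] *)

Section Relations.
Variables (k : fieldType) (d : nat) (Phi : Dform k).
Local Notation R := {mpoly k[3]}.
Local Notation x := (vx k).
Local Notation y := (vy k).
Local Notation z := (vz k).
Local Notation n := d.+1.
Local Notation N := (Nn n).
Local Notation phi := (xPhi n Phi).
Local Notation p := (pmat n Phi).
Local Notation I := (ann phi).
Hypothesis p_unit : p \in unitmx.
Local Notation W := (W Phi).
Local Notation u := (u Phi).
Local Notation g2 := (g2 Phi).
Local Notation psi := (psi Phi).

Definition gen1 : 'cV[R]_n := \col_i (x * W i).
Definition gen2 : 'cV[R]_n.+1 := \col_j g2 j.
Definition gen : 'cV[R]_(n + n.+1) := col_mx gen1 gen2.

Lemma repc_psi j l : repc d Phi (psi j) 0 l = ((rmat n Phi)^T *m invmx p) j l.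
Proof.
rewrite mxE [RHS]mxE; apply: eq_bigr => i _; congr (_ * _).
by rewrite !mxE /psi mulrC.
Qed.

Lemma B0E j l : B0 n Phi j l = psi j (W l).
Proof. by rewrite -repc_W //; [rewrite repc_psi mxE | apply: psi_lin]. Qed.

Lemma psi_u j j' : psi j' (u j) = ((rmat n Phi)^T *m invmx p *m rmat n Phi) j j'.
Proof.
rewrite /u /rep (phi_sum (psi_lin _ _)) mxE; apply: eq_bigr => l _.
by rewrite (phiZ (psi_lin _ _)) repc_psi [rmat _ _ _ _]mxE /psi [_ * mbas _ _]mulrC.
Qed.

Lemma psi_u_sym (j j' : 'I_n.+1) : psi j (u j') = psi j' (u j).
Proof. by rewrite -(phi_u p_unit j (u_homog Phi j')) -(phi_u p_unit j' (u_homog Phi j)) mulrC. Qed.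

Lemma A0E (i t : 'I_n) : A0 n Phi i t = psi (dn i) (u (up t)).
Proof. by rewrite psi_u_sym psi_u mxE mxE. Qed.

Lemma Bmx_row (i : 'I_n) (j : 'I_n.+1) : Bmx n Phi i j =
  x * (oapp (fun l => (psi (dn i) (W l))%:MP) 0 (unlift ord0 j)
       - oapp (fun l => (psi (up i) (W l))%:MP) 0 (unlift ord_max j))
  + (oapp (fun l => z *+ (i == l)) 0 (unlift ord_max j)
     - oapp (fun l => y *+ (i == l)) 0 (unlift ord0 j)).
Proof.
rewrite /Bmx /B1 /B2 [LHS]mxE; congr (_ + _).
  rewrite mxE; congr (_ * _); rewrite mxE mxE [X in (_ + X)%:MP]mxE row_mx0lE row_mx0rE mpolyCB.
  congr (_ - _); case: unliftP => [l _|_] /=; rewrite ?mpolyC0 // -?B0E mxE //.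
rewrite mxE [X in _ + X = _]mxE row_mx0lE row_mx0rE.
by congr (_ - _); case: unliftP => [l _|_] //=; rewrite mxE.
Qed.

Lemma QmxE i l : Qmx n Phi i l = (W i)@_(bexp (ridx l)).
Proof.
rewrite mxE mcoeff_mbas_comb mxE (bigD1 (ridx i)) //= big1 ?addr0 => [|j ji].
  by rewrite mxE mcoeff_mbas eqxx mul1r.
by rewrite mxE mcoeff_mbas (negbTE ji) mul0r.
Qed.

Lemma D0E j j' : D0 n Phi j j' =
  oapp (fun l => oapp (fun l' => (W l)@_(bexp (ridx l'))) 0 (unlift ord0 j')) 0 (unlift ord_max j).
Proof.
rewrite /D0 castmxE /= cast_ord_id /block_mx mxE; case: splitP => [l|j0] E.
  have -> : j = lift ord_max l by apply: val_inj; move: E; rewrite /= /bump [(n <= l)%N]leqNgt ltn_ord.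
  rewrite row_mx0lE liftK /=; case: unliftP => [l' _|_] //=; exact: QmxE.
rewrite [LHS](_ : _ = 0); last by rewrite mxE; case: splitP => ? _; rewrite mxE.
case: (unliftP ord_max j) => [l jE|_] //; move: E; rewrite jE /= /bump; have := ltn_ord l.
by move=> /= ltl E; exfalso; lia.
Qed.

Lemma W_sym (i l : 'I_n) : (W i)@_(bexp (ridx l)) = (W l)@_(bexp (ridx i)).
Proof. by rewrite -!QmxE !mxE; apply: pinv_sym. Qed.

(** Row i is x times [key_relation] for [psi (dn i)] and [psi (up i)]: since z m0_(dn i) = y m0_(up
    i), the [B2] part is - x (z u_(dn i) - y u_(up i)). *)
Lemma gen_relation_top : Amx n Phi *m gen1 + Bmx n Phi *m gen2 = 0.
Proof.
apply/colP => i; rewrite [RHS]mxE mxE.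
have -> : (Amx n Phi *m gen1) i 0 =
    x * \sum_(t < n) (psi (dn i) (u (up t)) - psi (up i) (u (dn t))) *: (x * W t).
  rewrite mxE mulr_sumr; apply: eq_bigr => t _.
  rewrite [X in X * _]mxE mxE [X in _ * X]mxE [X in X%:MP]mxE [X in (_ + X)%:MP]mxE.
  rewrite [X in (_ - X)%:MP]mxE !A0E (psi_u_sym (dn t)) -mulrA; congr (_ * _).
  by rewrite mul_mpolyC.
have -> : (Bmx n Phi *m gen2) i 0 =
    x * (\sum_(l < n) psi (dn i) (W l) *: g2 (up l) - \sum_(l < n) psi (up i) (W l) *: g2 (dn l))
    + (z * g2 (dn i) - y * g2 (up i)).
  rewrite mxE (eq_bigr (fun j => x * (oapp (fun l : 'I_n => (psi (dn i) (W l))%:MP) 0 (unlift ord0 j) * g2 j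
       - oapp (fun l : 'I_n => (psi (up i) (W l))%:MP) 0 (unlift ord_max j) * g2 j)
     + (oapp (fun l : 'I_n => z *+ (i == l)) 0 (unlift ord_max j) * g2 j
     - oapp (fun l : 'I_n => y *+ (i == l)) 0 (unlift ord0 j) * g2 j))); last first.
    by move=> j _; rewrite Bmx_row mxE mulrDl -mulrA !mulrBl.
  rewrite big_split -mulr_sumr !sumrB /= !sum_unlift; congr (_ * (_ - _) + (_ - _)).
  - by apply: eq_bigr => l _; rewrite mul_mpolyC.
  - by apply: eq_bigr => l _; rewrite mul_mpolyC.
  - rewrite (bigD1 i) //= eqxx big1 ?addr0 // => l li; rewrite eq_sym (negbTE li) mul0r //.
  - rewrite (bigD1 i) //= eqxx big1 ?addr0 // => l li; rewrite eq_sym (negbTE li) mul0r //.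
have zy f : psi (dn i) (z * f) = psi (up i) (y * f).
  by rewrite /psi -z_mu -y_mu; congr (Deval _ _ _); ring.
have E := key_relation p_unit (psi_lin Phi (dn i)) (psi_lin Phi (up i)) zy.
have -> : z * g2 (dn i) - y * g2 (up i) =
    - x * (z * rep d Phi (psi (dn i)) - y * rep d Phi (psi (up i))).
  rewrite -/(u (dn i)) -/(u (up i)) /g2 -z_mu -y_mu.
  by move: (u (dn i)) (u (up i)) (mu k i) => a b c; ring.
have cancel (s1 s2 s3 : R) : x * s1 + (x * (s2 - s3) + - x * (s2 - s3 + s1)) = 0 by ring.
rewrite E; exact: cancel.
Qed.

(** [lamD j] and [lamU j] read the coefficients of mu_j and mu_(j-1); the value 0 when that monomial
    does not exist matches the zero padding of [D0]. *)
Definition lamD (j : 'I_n.+1) (f : R) : k :=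
  oapp (fun l => f@_(@bexp d (ridx l))) 0 (unlift ord_max j).
Definition lamU (j : 'I_n.+1) (f : R) : k :=
  oapp (fun l => f@_(@bexp d (ridx l))) 0 (unlift ord0 j).

Lemma lamD_lin j : lin_fun (lamD j).
Proof.
rewrite /lamD => c f g; case: unliftP => [l _|_] /=; last by rewrite mulr0 addr0.
by rewrite mcoeffD mcoeffZ.
Qed.

Lemma lamU_lin j : lin_fun (lamU j).
Proof.
rewrite /lamU => c f g; case: unliftP => [l _|_] /=; last by rewrite mulr0 addr0.
by rewrite mcoeffD mcoeffZ.
Qed.

Lemma rep0 : rep d Phi (fun=> 0) = 0.
Proof.
rewrite /rep big1 // => l _; rewrite mxE big1 ?scale0r // => i _.
by rewrite mxE mul0r.
Qed.

Lemma rep_lamD j : rep d Phi (lamD j) = oapp W 0 (unlift ord_max j).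
Proof. by rewrite /lamD; case: unliftP => [l _|_] //=; rewrite rep0. Qed.

Lemma rep_lamU j : rep d Phi (lamU j) = oapp W 0 (unlift ord0 j).
Proof. by rewrite /lamU; case: unliftP => [l _|_] //=; rewrite rep0. Qed.

Lemma mcoeff_MX (i : 'I_3) (m : 'X_{1..3}) (f : R) :
  ('X_i * f)@_m = if (0 < m i)%N then f@_(m - U_(i)) else 0.
Proof.
case: ltnP => mi.
  have -> : m = (U_(i) + (m - U_(i)))%MM.
    rewrite addmC submK //; apply/mnm_lepP => j; rewrite mnm1E; case: eqP => [<-|] //.
  by rewrite mulrC mcoeffMX addmC addmK.
rewrite (mpolyE f) mulr_sumr raddf_sum big1 //= => m' _.
rewrite -scalerAr mcoeffZ -mpolyXD mcoeffX; case: eqP => [E|_]; last by rewrite mulr0.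
by move: mi; rewrite -E mnmDE mnm1E eqxx.
Qed.

Lemma mon3_subz a b c : (mon3 a b c.+1 - U_(2%R))%MM = mon3 a b c.
Proof. by apply/mnmP; apply: ord3P; rewrite mnmBE !mnmDE !mulmnE !mnm1E /=; lia. Qed.

Lemma mon3_suby a b c : (mon3 a b.+1 c - U_(1%R))%MM = mon3 a b c.
Proof. by apply/mnmP; apply: ord3P; rewrite mnmBE !mnmDE !mulmnE !mnm1E /=; lia. Qed.

(** Both are the coefficient of y^(d-j) z^(j-1) in f, and both are 0 at the ends j = 0 and j = d +
    1. *)
Lemma lam_zy j f : lamD j (z * f) = lamU j (y * f).
Proof.
rewrite /lamD /lamU.
have -> : oapp (fun l => (z * f)@_(@bexp d (ridx l))) 0 (unlift ord_max j) =
    if (0 < j <= d)%N then f@_(mon3 0 (d - j) j.-1) else 0.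
  case: unliftP => [l ->|->]; last by rewrite /= ltnn.
  rewrite -/(dn l) dnE [LHS]/= bexp_ridx mcoeff_MX; have [_ _ ->] := mon3_exp 0 (d - l) l.
  have -> : (l <= d)%N by rewrite -ltnS.
  by rewrite andbT; case: (nat_of_ord l) => // l' /=; rewrite mon3_subz.
case: unliftP => [l ->|->] //=.
rewrite bexp_ridx mcoeff_MX; have [_ -> _] := mon3_exp 0 (d - l) l.
rewrite /bump add1n /= subn_gt0; case: ltnP => // ltl.
by rewrite subnS; case: (d - l)%N (subn_gt0 l d) => [|e] /=; rewrite ?ltl // mon3_suby.
Qed.

Lemma D0_lamD j j' : D0 n Phi j j' = oapp (fun l => lamD j (W l)) 0 (unlift ord0 j').
Proof.
rewrite D0E /lamD; case: (unlift ord_max j) => [l|]; case: (unlift ord0 j') => [l'|].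
- exact: W_sym.
- exact: (erefl (0 : k)).
- exact: (erefl (0 : k)).
- exact: (erefl (0 : k)).
Qed.

Lemma D0_lamU j j' : D0 n Phi j' j = oapp (fun l => lamU j (W l)) 0 (unlift ord_max j').
Proof. by rewrite D0E. Qed.

(** Row j is, up to sign, x times [key_relation] for [lamD j] and [lamU j], whose representatives
    are W_j and W_(j-1), or 0 at the ends. *)
Lemma gen_relation_bottom : - (Bmx n Phi)^T *m gen1 + Dmx n Phi *m gen2 = 0.
Proof.
apply/colP => j; rewrite [RHS]mxE mxE mulNmx [X in X + _]mxE.
have -> : ((Bmx n Phi)^T *m gen1) j 0 =
    - x * (\sum_(i < n) (lamD j (u (up i)) - lamU j (u (dn i))) *: (x * W i))
    + (z * (x * rep d Phi (lamD j)) - y * (x * rep d Phi (lamU j))).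
  rewrite mxE (eq_bigr (fun i : 'I_n => - x * ((lamD j (u (up i)) - lamU j (u (dn i))) *: (x * W i))
    + (oapp (fun l : 'I_n => z *+ (i == l)) 0 (unlift ord_max j) * (x * W i)
     - oapp (fun l : 'I_n => y *+ (i == l)) 0 (unlift ord0 j) * (x * W i)))).
    rewrite big_split -mulr_sumr !sumrB /= rep_lamD rep_lamU; congr (_ + (_ - _)).
      case: unliftP => [l _|_] /=; last by rewrite !mulr0 big1 // => i _; rewrite mul0r.
      rewrite (bigD1 l) //= eqxx big1 ?addr0 // => i il; rewrite (negbTE il) mul0r //.
    case: unliftP => [l _|_] /=; last by rewrite !mulr0 big1 // => i _; rewrite mul0r.
    rewrite (bigD1 l) //= eqxx big1 ?addr0 // => i il; rewrite (negbTE il) mul0r //.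
  move=> i _; rewrite [X in X * _]mxE [X in _ * X]mxE Bmx_row.
  have -> : oapp (fun l : 'I_n => (psi (dn i) (W l))%:MP) 0 (unlift ord0 j) = (lamU j (u (dn i)))%:MP :> R.
    rewrite /lamU; case: (unlift ord0 j) => [l|] /=; last by rewrite mpolyC0.
    by rewrite mcoeff_mbas_comb repc_W //; apply: psi_lin.
  have -> : oapp (fun l : 'I_n => (psi (up i) (W l))%:MP) 0 (unlift ord_max j) = (lamD j (u (up i)))%:MP :> R.
    rewrite /lamD; case: (unlift ord_max j) => [l|] /=; last by rewrite mpolyC0.
    by rewrite mcoeff_mbas_comb repc_W //; apply: psi_lin.
  rewrite -mul_mpolyC mpolyCB; move: (x * W i) (oapp _ _ _) (oapp _ _ _) => a b c.
  by move: (_%:MP) (_%:MP) => e f; ring.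
have -> : (Dmx n Phi *m gen2) j 0 = x * (\sum_(l < n) lamD j (W l) *: g2 (up l)
    - \sum_(l < n) lamU j (W l) *: g2 (dn l)).
  rewrite mxE (eq_bigr (fun j' => x * ((D0 n Phi j j')%:MP * g2 j' - (D0 n Phi j' j)%:MP * g2 j'))).
    rewrite -mulr_sumr sumrB; congr (_ * (_ - _)).
      under eq_bigr do rewrite D0_lamD.
      exact: sum_unliftC.
    under eq_bigr do rewrite D0_lamU.
    exact: sum_unliftC.
  move=> j' _; rewrite [X in X * _]mxE mxE [X in _ * X]mxE [X in X%:MP]mxE.
  by rewrite [X in (_ + X)%:MP]mxE [X in (_ - X)%:MP]mxE mpolyCB -mulrA mulrBl.
have E := key_relation p_unit (lamD_lin j) (lamU_lin j) (lam_zy j).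
have cancel (s1 s2 s3 a b : R) : z * a - y * b = s2 - s3 + s1 ->
    - (- x * s1 + (z * (x * a) - y * (x * b))) + x * (s2 - s3) = 0.
  move=> Eab; have -> : z * (x * a) - y * (x * b) = x * (z * a - y * b) by ring.
  by rewrite Eab; ring.
exact: cancel E.
Qed.

Lemma b2_gen : b2 n Phi *m gen = 0.
Proof.
by rewrite mul_block_col gen_relation_top gen_relation_bottom; apply: col_mx0.
Qed.

End Relations.

(** Iterating the step leaves a remainder divisible by a high power of the variable, invisible in
    the degrees where v lives; since M is homogeneous, w can be truncated to match those degrees. *)
Lemma graded_nakayama (k : fieldType) m (t : 'I_m) r c e (M : 'M[{mpoly k[m]}]_(r, c))
    (Z : 'cV[{mpoly k[m]}]_r -> Prop) :
  (forall i j, M i j \is e.-homog) ->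
  (forall v, Z v -> exists w v', Z v' /\ v = M *m w + 'X_t *: v') ->
  forall v, Z v -> exists w, v = M *m w.
Proof.
move=> hM step v Zv.
have iterS K : exists w v', Z v' /\ v = M *m w + 'X_t ^+ K *: v'.
  elim: K => [|K [w [v' [/step[w' [v'' [Zv'' ->]]] ->]]]].
    by exists 0, v; rewrite mulmx0 add0r expr0 scale1r.
  exists (w + 'X_t ^+ K *: w'), v''; split=> //.
  by rewrite mulmxDr -scalemxAr scalerDr scalerA addrA exprSr.
(* [mmeasure] is one more than the degree, so all homogeneous parts of v have degree below K. *)
pose K := (\max_i mmeasure mdeg (v i 0%R))%N.
have [w [v' [_ vE]]] := iterS K.
exists (\col_j \sum_(s < K | (e <= s)%N) pihomog mdeg (s - e) (w j 0)).
apply/colP => i.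
have leK : (mmeasure mdeg (v i 0%R) <= K)%N by apply: (@leq_bigmax _ (fun i => mmeasure mdeg (v i 0%R))).
rewrite [LHS](pihomog_partitionE leK) mxE.
under [RHS]eq_bigr do rewrite mxE mulr_sumr.
rewrite exchange_big /= [RHS]big_mkcond /=; apply: eq_bigr => s _.
have -> : v i 0 = (M *m w) i 0 + 'X_t ^+ K * v' i 0 by rewrite vE !mxE.
have hX : ('X_t ^+ K : {mpoly k[m]}) \is (1 * K).-homog by apply/dhomogMn/dhomogXU.
rewrite raddfD /= (pihomog_Mhomog0 _ hX) ?mul1n // addr0 mxE raddf_sum /=.
case: leqP => es; last by rewrite big1 // => j _; rewrite (pihomog_Mhomog0 _ (hM i j)).
by apply: eq_bigr => j _; rewrite -{1}(subnKC es) (pihomog_Mhomog _ _ (hM i j)).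
Qed.

(** * Exactness *)

Section ModX.
Variable k : fieldType.
Local Notation R := {mpoly k[3]}.
Local Notation x := (vx k).
Local Notation y := (vy k).
Local Notation z := (vz k).
Local Notation ev := (ev0 (0 : 'I_3)).

Lemma ev_ev (f : R) : ev (ev f) = ev f.
Proof.
have [q E] := ev0_divX 0 f.
by rewrite {2}E rmorphD rmorphM /= ev0x_x mul0r addr0.
Qed.

Lemma ev_yz a b : ev (y ^+ a * z ^+ b) = y ^+ a * z ^+ b.
Proof. by rewrite rmorphM !rmorphXn /= ev0x_y ev0x_z. Qed.

Lemma ev_xM f : ev (x * f) = 0.
Proof. by rewrite rmorphM /= ev0x_x mul0r. Qed.

Lemma col_divx r (v : 'cV[R]_r) : (forall i, ev (v i 0) = 0) -> exists v', v = x *: v'.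
Proof.
move=> H; have /fin_all_exists[q qE] : forall i, exists q, v i 0 = x * q.
  by move=> i; apply: ev0_eq0.
by exists (\col_i q i); apply/colP => i; rewrite !mxE.
Qed.

(** The kernel of [B2]. In the induction, z^(m+1) s is divisible by y, hence so is s. *)
Lemma geometric_yz m (f : nat -> R) : (forall i, (i < m)%N -> z * f i = y * f i.+1) ->
  exists s, forall j, (j <= m)%N -> f j = y ^+ (m - j) * z ^+ j * s.
Proof.
elim: m => [|m IH] H.
  by exists (f 0%N) => j; rewrite leqn0 => /eqP ->; rewrite !expr0 !mul1r.
have [s sE] := IH (fun i lt => H i (ltnW lt)).
have E : z ^+ m.+1 * s = y * f m.+1.
  by rewrite -H // sE // subnn expr0 mul1r exprS mulrA.
have [t sE'] : exists t, s = y * t.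
  have : ev0 1 s = 0.
    have := congr1 (ev0 1) E; rewrite !rmorphM rmorphXn /= !ev0X /= mul0r.
    by move/eqP; rewrite mulf_eq0 expf_eq0 (negbTE (mpolyX_neq0 _ _)) => /eqP.
  exact: ev0_eq0.
exists t => j; rewrite leq_eqVlt => /orP[/eqP ->|lt].
  rewrite subnn expr0 mul1r; apply: (@mulX_inj _ _ 1); rewrite -/y -E sE'; ring.
by rewrite sE // sE' subSn // exprS; ring.
Qed.

Lemma ladder_yz m (f : nat -> R) : z * f 0%N = 0 ->
  (forall i, (i.+1 < m)%N -> z * f i.+1 = y * f i) -> forall i, (i < m)%N -> f i = 0.
Proof.
move=> H0 H; elim=> [|i IH] lt; apply: (@mulX_inj _ _ 2); rewrite -/z mulr0 //.
by rewrite H // IH ?mulr0 // ltnW.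
Qed.

(** Setting z = 0 shows that z divides the first coefficient; moving that term onto the next one and
    cancelling z shortens the relation. *)
Lemma syzygy_yz m (f : nat -> R) : \sum_(j < m.+1) y ^+ (m - j) * z ^+ j * f j = 0 ->
  exists t : nat -> R, forall j, (j <= m)%N ->
    f j = (if (j < m)%N then z * t j else 0) - (if (0 < j)%N then y * t j.-1 else 0).
Proof.
elim: m f => [|m IH] f.
  rewrite big_ord1 !expr0 !mul1r => f0; exists (fun=> 0) => j.
  by rewrite leqn0 => /eqP ->; rewrite f0 subrr.
rewrite big_ord_recl /= expr0 mulr1 subn0 => E.
have [t0 f0E] : exists t0, f 0%N = z * t0.
  have := congr1 (ev0 2) E; rewrite rmorph0 rmorphD rmorph_sum /= big1 ?addr0.
    rewrite rmorphM rmorphXn /= ev0X /= => /eqP.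
    by rewrite mulf_eq0 expf_eq0 (negbTE (mpolyX_neq0 _ _)) => /eqP/ev0_eq0.
  by move=> i _; rewrite exprS !rmorphM /= ev0X /= mul0r mulr0 mul0r.
pose f' j := f j.+1 + (if j == 0%N then y * t0 else 0).
have [|t tE] := IH f'.
  apply: (@mulX_inj _ _ 2); rewrite mulr0; apply: (etrans _ E); rewrite f0E -/z mulr_sumr.
  rewrite big_ord_recl [X in _ = _ + X]big_ord_recl /f' /=.
  rewrite (eq_bigr (fun i : 'I_m => y ^+ (m.+1 - bump 0 (bump 0 i)) * z ^+ bump 0 (bump 0 i) * f (bump 0 (bump 0 i)))).
    rewrite !subn0 subSS subn0 expr0 expr1 exprS; ring.
  move=> i _; rewrite /bump /= !add1n addr0 subSS !exprS; move: (y ^+ _) (z ^+ i) (f _) => a b c; ring.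
exists (fun j => if j is j'.+1 then t j' else t0) => -[|j] lej /=.
  by rewrite f0E subr0.
have := tE j lej; rewrite /f' ltnS => E'.
have -> : f j.+1 = f' j - (if j == 0%N then y * t0 else 0) by rewrite /f'; ring.
rewrite /f' E'; case: j {lej E'} => [|j] /=; ring.
Qed.

End ModX.

(** * The cokernel of the bidiagonal block modulo x *)

Section BidiagonalBlock.
Variables (k : fieldType) (n : nat).
Local Notation R := {mpoly k[3]}.
Local Notation x := (vx k).
Local Notation y := (vy k).
Local Notation z := (vz k).
Local Notation B2 := (B2 k n).

Lemma lift_max (l : 'I_n) : lift ord_max l = l :> nat.
Proof. by rewrite /= /bump leqNgt ltn_ord. Qed.

Lemma B2E i j : B2 i j = z *+ (j == i :> nat) - y *+ (j == i.+1 :> nat).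
Proof.
rewrite mxE [X in _ + X = _]mxE row_mx0lE row_mx0rE; congr (_ - _).
  case: unliftP => [l ->|->] /=.
    by rewrite mxE /bump leqNgt ltn_ord /= eq_sym.
  by rewrite gtn_eqF.
case: unliftP => [l ->|->] //=.
by rewrite mxE /bump eqSS eq_sym.
Qed.

Lemma B2_mul (v : 'cV[R]_n.+1) i :
  (B2 *m v) i 0 = z * v (lift ord_max i) 0 - y * v (lift ord0 i) 0.
Proof.
rewrite mxE (eq_bigr (fun j : 'I_n.+1 => z *+ (j == i :> nat) * v j 0 - y *+ (j == i.+1 :> nat) * v j 0)).
  rewrite sumrB (bigD1 (lift ord_max i)) // lift_max eqxx big1 ?addr0 => [|j /= jl]; last first.
    have -> : (j == i :> nat) = (j == lift ord_max i) by rewrite -(inj_eq val_inj) -[val (lift _ _)]/(lift ord_max i : nat) lift_max.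
    by rewrite (negbTE jl) mul0r.
  rewrite (bigD1 (lift ord0 i)) //= eqxx big1 ?addr0 // => j jl.
  by rewrite -[i.+1]/(val (lift ord0 i)) (inj_eq val_inj) (negbTE jl) mul0r.
by move=> j _; rewrite B2E mulrBl.
Qed.

Lemma B2T_mul (v : 'cV[R]_n) (f : nat -> R) (j : 'I_n.+1) : (forall i : 'I_n, v i 0 = f i) ->
  (B2^T *m v) j 0 = (if (j < n)%N then z * f j else 0) - (if (0 < j)%N then y * f j.-1 else 0).
Proof.
move=> vf.
rewrite mxE (eq_bigr (fun i : 'I_n => z *+ (j == i :> nat) * f i - y *+ (j == i.+1 :> nat) * f i)).
  rewrite sumrB; congr (_ - _).
    case: ltnP => jn; last by rewrite big1 // => i _; rewrite gtn_eqF ?mul0r // (leq_trans (ltn_ord i)).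
    rewrite (bigD1 (Ordinal jn)) //= eqxx big1 ?addr0 // => i ij.
    by rewrite -[nat_of_ord j]/(val (Ordinal jn)) (inj_eq val_inj) eq_sym (negbTE ij) mul0r.
  case: ltnP => j0; last first.
    by rewrite big1 // => i _; rewrite ltn_eqF ?mul0r //; lia.
  have jn : (j.-1 < n)%N by have := ltn_ord j; lia.
  rewrite (bigD1 (Ordinal jn)) //= prednK // eqxx big1 ?addr0 // => i ij.
  have -> : (j == i.+1 :> nat) = (Ordinal jn == i) by rewrite -(inj_eq val_inj) /=; lia.
  by rewrite eq_sym (negbTE ij) mul0r.
by move=> i _; rewrite mxE B2E vf mulrBl.
Qed.

Definition ecol (i : nat) : 'cV[R]_n := \col_j (j == i :> nat)%:R.

Lemma ecol_out i : (n <= i)%N -> ecol i = 0.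
Proof.
move=> ni; apply/colP => j; rewrite !mxE ltn_eqF //; exact: leq_trans (ltn_ord j) ni.
Qed.

Lemma col_ecol (v : 'cV[R]_n) : v = \sum_(i < n) v i 0 *: ecol i.
Proof.
apply/colP => j; rewrite summxE (bigD1 j) //= !mxE eqxx mulr1 big1 ?addr0 // => i ij.
by rewrite !mxE (inj_eq val_inj) eq_sym (negbTE ij) mulr0.
Qed.

Definition imB2 (v : 'cV[R]_n) := exists w, v = B2 *m w.

Lemma imB2D u v : imB2 u -> imB2 v -> imB2 (u + v).
Proof. by move=> [w ->] [w' ->]; exists (w + w'); rewrite mulmxDr. Qed.

Lemma imB2Z c v : imB2 v -> imB2 (c *: v).
Proof. by move=> [w ->]; exists (c *: w); rewrite scalemxAr. Qed.

Lemma imB2_z0 : imB2 (z *: ecol 0).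
Proof.
exists (delta_mx ord0 0); apply/colP => i; rewrite B2_mul !mxE !eqxx !andbT.
by rewrite -!val_eqE /= /bump leqNgt ltn_ord /= mulr0 subr0.
Qed.

Lemma imB2_zS i : (i < n)%N -> imB2 (z *: ecol i.+1 - y *: ecol i).
Proof.
move=> ltin; exists (delta_mx (lift ord0 (Ordinal ltin)) 0); apply/colP => j.
rewrite B2_mul !mxE !eqxx !andbT -!val_eqE /= /bump leqNgt ltn_ord /=.
by rewrite add0n !add1n eqSS.
Qed.

(** Modulo the image y e_i = z e_(i+1), so each factor y raises the index, until it reaches n, where
    [ecol] is 0. *)
Lemma imB2_high b i : (n <= b + i)%N -> imB2 (y ^+ b *: ecol i).
Proof.
elim: b i => [|b IH] i nbi.
  by rewrite ecol_out // scaler0; exists 0; rewrite mulmx0.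
have [ltin|/ecol_out ->] := ltnP i n; last by rewrite scaler0; exists 0; rewrite mulmx0.
have -> : y ^+ b.+1 *: ecol i = z *: (y ^+ b *: ecol i.+1)
    + (- y ^+ b) *: (z *: ecol i.+1 - y *: ecol i).
  by apply/colP => j; rewrite !mxE exprS; ring.
apply: imB2D; apply: imB2Z; last exact: imB2_zS.
by apply: IH; rewrite addnS.
Qed.

(** Normal forms of the cokernel of [B2] modulo x: z e_0 = 0 and z e_(i+1) = y e_i eliminate z, and
    [imB2_high] bounds the exponent of y. *)
Definition yform (q : 'I_n -> 'I_n -> k) : 'cV[R]_n :=
  \sum_(i < n) \sum_(e < n | (e + i < n)%N) ((q i e)%:MP * y ^+ e) *: ecol i.

Definition reducible (v : 'cV[R]_n) := exists w q a, v = B2 *m w + yform q + x *: a.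

Lemma yformD q q' : yform (fun i e => q i e + q' i e) = yform q + yform q'.
Proof.
rewrite -big_split; apply: eq_bigr => i _; rewrite -big_split; apply: eq_bigr => e _ /=.
by rewrite mpolyCD mulrDl scalerDl.
Qed.

Lemma yform0 : yform (fun _ _ => 0) = 0.
Proof. by rewrite /yform big1 // => i _; rewrite big1 // => e _; rewrite mpolyC0 mul0r scale0r. Qed.

Lemma reducibleD u v : reducible u -> reducible v -> reducible (u + v).
Proof.
move=> [w [q [a ->]]] [w' [q' [a' ->]]]; exists (w + w'), (fun i e => q i e + q' i e), (a + a').
rewrite mulmxDr yformD scalerDr; move: (B2 *m w) (B2 *m w') (yform _) (yform _) => b b' c c'.
by apply/colP => i; rewrite !mxE; ring.
Qed.

Lemma reducible_im v : imB2 v -> reducible v.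
Proof. by move=> [w ->]; exists w, (fun _ _ => 0), 0; rewrite yform0 scaler0 !addr0. Qed.

Lemma reducible0 : reducible 0.
Proof. by apply: reducible_im; exists 0; rewrite mulmx0. Qed.

Lemma reducible_x a : reducible (x *: a).
Proof. by exists 0, (fun _ _ => 0), a; rewrite yform0 mulmx0 !add0r. Qed.

Lemma reducible_sum J (r : seq J) (P : pred J) (F : J -> 'cV[R]_n) :
  (forall i, P i -> reducible (F i)) -> reducible (\sum_(i <- r | P i) F i).
Proof. by move=> H; apply: big_ind => //; [apply: reducible0 | apply: reducibleD]. Qed.

Lemma reducible_yE c e i : reducible ((c%:MP * y ^+ e) *: ecol i).
Proof.
have [lt|le] := ltnP (e + i) n; last first.
  by rewrite -scalerA; apply: reducible_im; apply: imB2Z; apply: imB2_high.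
have ln : (i < n)%N by lia. have en : (e < n)%N by lia.
exists 0, (fun i' e' => if (i' == Ordinal ln) && (e' == Ordinal en) then c else 0), 0.
rewrite mulmx0 add0r scaler0 addr0 /yform (bigD1 (Ordinal ln)) //= (bigD1 (Ordinal en)) //= !eqxx.
rewrite !big1 ?addr0 // => [i' /negbTE ->|e' /andP[_ /negbTE ->]].
  by rewrite big1 // => e' _; rewrite mpolyC0 mul0r scale0r.
by rewrite mpolyC0 mul0r scale0r.
Qed.

Lemma reducible_z v : reducible v -> reducible (z *: v).
Proof.
move=> [w [q [a ->]]]; rewrite !scalerDr; apply: reducibleD; last first.
  by rewrite scalerA mulrC -scalerA; apply: reducible_x.
apply: reducibleD; first by apply: reducible_im; apply: imB2Z; exists w.
rewrite scaler_sumr; apply: reducible_sum => i _; rewrite scaler_sumr.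
apply: reducible_sum => e _; rewrite scalerA mulrC -scalerA.
case: i => [[|i] lti] /=.
  by apply: reducible_im; apply: imB2Z; apply: imB2_z0.
have -> : z *: ecol i.+1 = (z *: ecol i.+1 - y *: ecol i) + y *: ecol i by rewrite subrK.
rewrite scalerDr; apply: reducibleD.
  by apply: reducible_im; apply: imB2Z; apply: imB2_zS; apply: ltnW.
rewrite scalerA -mulrA -exprSr; exact: reducible_yE.
Qed.

Lemma reducibleP v : reducible v.
Proof.
rewrite (col_ecol v); apply: reducible_sum => i _.
rewrite (mpolyE (v i 0)) scaler_suml; apply: reducible_sum => m _.
move: (v i 0)@_m => s; rewrite (mnm3P m) mon3E; move: (m 0%R) (m 1%R) (m 2%R) => a b c.
rewrite -mul_mpolyC.
have -> : (s%:MP * (x ^+ a * y ^+ b * z ^+ c)) *: ecol i =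
    x ^+ a *: (z ^+ c *: ((s%:MP * y ^+ b) *: ecol i)).
  by rewrite !scalerA; congr (_ *: _); ring.
case: a => [|a]; last by rewrite exprS -scalerA; apply: reducible_x.
rewrite expr0 scale1r; elim: c => [|c IH]; first by rewrite expr0 scale1r; apply: reducible_yE.
by rewrite exprS -scalerA; apply: reducible_z.
Qed.

End BidiagonalBlock.

(** * Kernels of [b2] and of [gen^T] *)

Section Exactness.
Variables (k : fieldType) (d : nat) (Phi : Dform k).
Local Notation R := {mpoly k[3]}.
Local Notation x := (vx k).
Local Notation y := (vy k).
Local Notation z := (vz k).
Local Notation n := d.+1.
Local Notation phi := (xPhi n Phi).
Local Notation p := (pmat n Phi).
Local Notation I := (ann phi).
Hypothesis p_unit : p \in unitmx.
Local Notation W := (W Phi).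
Local Notation u := (u Phi).
Local Notation g2 := (g2 Phi).
Local Notation gen := (gen d Phi).
Local Notation b2 := (b2 n Phi).
Local Notation B2 := (B2 k n).
Local Notation ev := (ev0 (0 : 'I_3)).
Let phi_lin := xPhi_lin n Phi.

Lemma scalex_eq0 r c (M : 'M[R]_(r, c)) : x *: M = 0 -> M = 0.
Proof.
move=> /matrixP E; apply/matrixP => i j; apply: mulx_inj.
by have := E i j; rewrite !mxE mulr0.
Qed.

Lemma cmx_skew m (M : 'M[k]_m) : (x *: cmx (M - M^T))^T = - (x *: cmx (M - M^T)).
Proof. by apply/matrixP => i j; rewrite !mxE -mulrN -mpolyCN opprB. Qed.

Lemma b2_skew : b2^T = - b2.
Proof.
by rewrite /b2 tr_block_mx !cmx_skew linearN /= trmxK opp_block_mx opprK.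
Qed.

Lemma b2_diag i : b2 i i = 0.
Proof.
rewrite -[i]splitK; case: (split i) => [j|j] /=.
  by rewrite block_mxEul !mxE subrr mpolyC0 mulr0.
by rewrite block_mxEdr !mxE subrr mpolyC0 mulr0.
Qed.

Lemma xC_homog (c : k) : x * c%:MP \is 1.-homog.
Proof. by rewrite mulrC mul_mpolyC rpredZ ?vx_homog. Qed.

Lemma Bmx_homog i j : Bmx n Phi i j \is 1.-homog.
Proof.
rewrite mxE rpredD //; first by rewrite mxE mxE xC_homog.
by rewrite B2E rpredB // rpredMn ?vy_homog ?vz_homog.
Qed.

Lemma b2_homog i j : b2 i j \is 1.-homog.
Proof.
rewrite -[i]splitK -[j]splitK; case: (split i) => {}i; case: (split j) => {}j /=.
- by rewrite block_mxEul mxE mxE xC_homog.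
- by rewrite block_mxEur Bmx_homog.
- by rewrite block_mxEdl mxE rpredN mxE Bmx_homog.
- by rewrite block_mxEdr mxE mxE xC_homog.
Qed.

Lemma block_mul_modx a b (A : 'M[R]_a) (B C : 'M[R]_(a, b)) (D : 'M[R]_b)
    (v1 : 'cV[R]_a) (v2 : 'cV[R]_b) :
  block_mx (x *: A) (x *: B + C) (- (x *: B + C)^T) (x *: D) *m col_mx v1 v2 =
  col_mx (x *: (A *m v1 + B *m v2) + C *m v2) (x *: (D *m v2 - B^T *m v1) - C^T *m v1).
Proof.
have -> : (x *: B + C)^T = x *: B^T + C^T by apply/matrixP => i j; rewrite !mxE.
rewrite mul_block_col mulNmx !mulmxDl -!scalemxAl; congr col_mx.
  by rewrite scalerDr addrA.
by rewrite scalerBr opprD addrC addrA.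
Qed.

Lemma b2_mul (v1 : 'cV[R]_n) (v2 : 'cV[R]_n.+1) : exists c1 c2,
  b2 *m col_mx v1 v2 = col_mx (x *: c1 + B2 *m v2) (x *: c2 - B2^T *m v1).
Proof. by eexists; eexists; apply: block_mul_modx. Qed.

Lemma gen_b2 : gen^T *m b2 = 0.
Proof.
apply: trmx_inj; rewrite trmx_mul trmxK b2_skew mulNmx b2_gen // oppr0 trmx0 //.
Qed.

Lemma gen_homog_mx i j : gen i j \is n.-homog.
Proof.
rewrite -[i]splitK; case: (split i) => {}i /=.
  by rewrite col_mxEu mxE xW_homog.
by rewrite col_mxEd mxE g2_homog.
Qed.

(** Modulo x the upper half of v is killed by the injective transpose of [B2], and the lower half is
    a multiple of (y^(n-j) z^j), which is [gen] modulo x. *)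
Lemma ker_b2 (v : 'cV[R]_(n + n.+1)) : b2 *m v = 0 -> exists s, v = gen *m s.
Proof.
move: v; apply: (@graded_nakayama k 3 0 _ _ n gen (fun v => b2 *m v = 0) gen_homog_mx).
move=> v; rewrite -[v]vsubmxK; move: (usubmx v) (dsubmx v) => v1 v2 {v} Z.
have [c1 [c2 E]] := b2_mul v1 v2.
have [/colP E1 /colP E2] : x *: c1 + B2 *m v2 = 0 /\ x *: c2 - B2^T *m v1 = 0.
  by apply: eq_col_mx; rewrite col_mx0 -E.
pose f1 i := ev (v1 (inord i) 0); pose f2 j := ev (v2 (inord j) 0).
have f1E (i : 'I_n) : f1 i = ev (v1 i 0) by rewrite /f1 inord_val.
have f2E (j : 'I_n.+1) : f2 j = ev (v2 j 0) by rewrite /f2 inord_val.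
have [s sE] : exists s, forall j, (j <= n)%N -> f2 j = y ^+ (n - j) * z ^+ j * s.
  apply: geometric_yz => i lti.
  have := E1 (Ordinal lti); rewrite mxE [X in X + _]mxE B2_mul [RHS]mxE => /(congr1 ev).
  rewrite rmorphD /= ev_xM add0r rmorphB !rmorphM rmorph0 /= ev0x_y ev0x_z -!f2E lift_max /=.
  by move/eqP; rewrite subr_eq0 => /eqP.
have f10 : forall i, (i < n)%N -> f1 i = 0.
  have B2T j : (j < n.+1)%N ->
      (if (j < n)%N then z * f1 j else 0) = (if (0 < j)%N then y * f1 j.-1 else 0) :> R.
    move=> ltj; have := E2 (Ordinal ltj).
    rewrite mxE [X in X + _]mxE [X in _ + X]mxE.
    rewrite (B2T_mul (f := fun i => v1 (inord i) 0)) => [|i]; last by rewrite inord_val.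
    rewrite [RHS]mxE => /(congr1 ev).
    rewrite rmorphD /= ev_xM add0r rmorphN rmorphB rmorph0 /= => /eqP.
    rewrite oppr_eq0 subr_eq0 => /eqP.
    by do 2!case: ifP => _; rewrite ?rmorphM ?rmorph0 /= ?ev0x_y ?ev0x_z.
  apply: ladder_yz => [|i lti]; first exact: (B2T 0%N).
  by have := B2T i.+1; rewrite lti /=; apply; apply: ltnW.
have [v' v'E] : exists v', col_mx v1 v2 - s *: gen = x *: v'.
  apply: col_divx => i; rewrite mxE [X in _ + X]mxE [X in _ - X]mxE -[i]splitK.
  case: (split i) => {}i /=.
    rewrite !col_mxEu [gen1 _ _ _ _]mxE rmorphB rmorphM /= ev_xM mulr0 subr0 /= -f1E.
    exact: f10.
  rewrite !col_mxEd [gen2 _ _ _ _]mxE rmorphB rmorphM /= rmorphB /= ev_xM subr0 /= /m0bas ev_yz.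
  rewrite -ev_ev -[ev (v2 i 0)]f2E sE; last by rewrite -ltnS.
  by rewrite rmorphM /= ev_yz mulrC subrr.
exists s%:M, v'; rewrite mul_mx_scalar -v'E; split; last by rewrite addrC subrK.
by apply: scalex_eq0; rewrite scalemxAr -v'E mulmxBr Z -scalemxAr b2_gen // scaler0 subrr.
Qed.

Lemma gen_mul (v1 : 'cV[R]_n) (v2 : 'cV[R]_n.+1) :
  (gen^T *m col_mx v1 v2) 0 0 = x * (\sum_i W i * v1 i 0) + \sum_j g2 j * v2 j 0.
Proof.
rewrite tr_col_mx mul_row_col mxE mulr_sumr !mxE; congr (_ + _).
  by apply: eq_bigr => i _; rewrite !mxE mulrA.
by apply: eq_bigr => i _; rewrite !mxE.
Qed.

Lemma yform_entry q (i : 'I_n) :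
  yform q i 0 = \sum_(e < n | (e + i < n)%N) (q i e)%:MP * y ^+ e.
Proof.
rewrite /yform summxE (bigD1 i) //= [X in _ + X]big1 ?addr0 => [|j ji].
  by rewrite summxE; apply: eq_bigr => e _; rewrite !mxE eqxx mulr1.
by rewrite summxE big1 // => e _; rewrite !mxE (inj_eq val_inj) eq_sym (negbTE ji) mulr0.
Qed.

(** Testing against y^(d-e-i) z^i isolates q i e: the degree forces the exponent e, and the duality
    of [W] with [mu] forces the index i. *)
Lemma yform_ann (q : 'I_n -> 'I_n -> k) : I (\sum_i W i * yform q i 0) -> yform q = 0.
Proof.
move=> Iq; apply/colP => i; rewrite yform_entry mxE big1 // => e ei.
suff -> : q i e = 0 by rewrite mpolyC0 mul0r.
have := Iq (y ^+ (d - e - i) * z ^+ i); rewrite mulr_sumr (phi_sum phi_lin).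
have hyz a : y ^+ a * (y ^+ (d - e - i) * z ^+ i) \is (a + (d - e))%N.-homog.
  have -> : (a + (d - e) = 1 * a + (1 * (d - e - i) + 1 * i))%N by lia.
  by do ?apply: dhomogM; apply: dhomogMn; apply: dhomogXU.
have term (i' e' : 'I_n) : phi (y ^+ (d - e - i) * z ^+ i * (W i' * ((q i' e')%:MP * y ^+ e'))) =
    if (i' == i) && (e' == e) then q i e else 0.
  have -> : y ^+ (d - e - i) * z ^+ i * (W i' * ((q i' e')%:MP * y ^+ e')) =
      q i' e' *: (W i' * (y ^+ e' * (y ^+ (d - e - i) * z ^+ i))).
    by rewrite -mul_mpolyC; ring.
  rewrite (phiZ phi_lin); have [->|ne] := eqVneq e' e; last first.
    rewrite andbF (phi_homog phi_lin (@xPhi_degS _ _ _) (dhomogM (W_homog Phi i') (hyz e'))) ?mulr0 //.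
    by apply: contra ne => /eqP E; apply/eqP/val_inj => /=; have := ltn_ord e; lia.
  rewrite andbT phi_W //; last by have := hyz e; rewrite subnKC // -ltnS.
  rewrite mulrA -exprD; have -> : (e + (d - e - i) = d - i)%N by lia.
  rewrite -muE /mu mcoeff_mbas -(inj_eq val_inj) /= eqn_add2l eq_sym (inj_eq val_inj).
  by case: eqP => [->|_]; rewrite ?mulr1 ?mulr0.
rewrite (bigD1 i) //= big1 ?addr0 => [|i' i'i]; last first.
  rewrite yform_entry !mulr_sumr (phi_sum phi_lin) big1 // => e' _.
  by rewrite term (negbTE i'i).
rewrite yform_entry !mulr_sumr (phi_sum phi_lin) (bigD1 e) //= big1 ?addr0 => [|e' /andP[_ ee]].
  by rewrite term !eqxx.
by rewrite term (negbTE ee) andbF.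
Qed.

Lemma ker_gen (v : 'cV[R]_(n + n.+1)) : gen^T *m v = 0 -> exists w, v = b2 *m w.
Proof.
move: v; apply: (@graded_nakayama k 3 0 _ _ 1 b2 (fun v => gen^T *m v = 0) b2_homog).
move=> v; rewrite -[v]vsubmxK; move: (usubmx v) (dsubmx v) => v1 v2 {v} Z.
pose f2 j := ev (v2 (inord j) 0).
have f2E (j : 'I_n.+1) : f2 j = ev (v2 j 0) by rewrite /f2 inord_val.
(* Modulo x only the lower half is constrained, as a syzygy of the y^(n-j) z^j; a combination of the
   first n columns of [b2] makes it divisible by x. *)
have [t tE] : exists t : nat -> R, forall j, (j <= n)%N ->
    f2 j = (if (j < n)%N then z * t j else 0) - (if (0 < j)%N then y * t j.-1 else 0).
  apply: syzygy_yz; have := congr1 (fun M : 'cV[R]_1 => ev (M 0 0)) Z.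
  rewrite gen_mul rmorphD /= ev_xM add0r mxE rmorph0 rmorph_sum => E; apply: etrans E.
  apply: eq_bigr => j _; rewrite rmorphM /= rmorphB /= ev_xM subr0 /= /m0bas ev_yz f2E //.
pose tc : 'cV[R]_n := \col_i t i.
have [c1 [c2 E]] := b2_mul tc 0; rewrite mulmx0 addr0 in E.
have [v2' v2E] : exists v2', v2 + (x *: c2 - B2^T *m tc) = x *: v2'.
  apply: col_divx => j; rewrite mxE [X in _ + X]mxE [X in _ + (X + _)]mxE [X in _ + (_ + X)]mxE.
  rewrite (B2T_mul (f := t)) => [|i]; last by rewrite mxE.
  rewrite -tE; last by rewrite -ltnS.
  by rewrite rmorphD rmorphB /= ev_xM sub0r /= f2E ev_ev subrr.
(* The upper half is free modulo x, so it is only brought to normal form. *)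
have [w [q [a v1E]]] := reducibleP (v1 + x *: c1).
have [c3 [c4 E']] := b2_mul 0 w; rewrite mulmx0 subr0 in E'.
have vE : col_mx v1 v2 + b2 *m col_mx tc 0 - b2 *m col_mx 0 w =
    col_mx (yform q + x *: (a - c3)) (x *: (v2' - c4)).
  rewrite E E' add_col_mx opp_col_mx add_col_mx v1E v2E !scalerBr; congr col_mx.
  move: (B2 *m w) (yform q) (x *: a) (x *: c3) => s1 s2 s3 s4.
  by apply/colP => i; rewrite !mxE; ring.
have gv : gen^T *m col_mx (yform q + x *: (a - c3)) (x *: (v2' - c4)) = 0.
  by rewrite -vE mulmxBr mulmxDr !mulmxA gen_b2 !mul0mx Z addr0 subr0.
(* Every term of the remaining relation has a factor x; cancelling it puts the combination of the
   W_i with coefficients from q into I. *)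
have q0 : yform q = 0.
  apply: yform_ann.
  have := congr1 (fun M : 'cV[R]_1 => M 0 0) gv; rewrite gen_mul [RHS]mxE.
  move: (a - c3) (v2' - c4) => a' b' gv0.
  have : \sum_i W i * yform q i 0 =
      - (\sum_i (x * W i) * a' i 0) - \sum_j g2 j * b' j 0.
    apply: mulx_inj; apply/eqP; rewrite -subr_eq0; apply/eqP; apply: etrans gv0.
    rewrite [X in _ = x * X + _](eq_bigr (fun i => W i * yform q i 0 + x * W i * a' i 0)); last first.
      by move=> i _; rewrite mxE [X in _ * (_ + X)]mxE mulrDr mulrA [W i * x]mulrC.
    rewrite big_split /= [X in _ = _ + X](eq_bigr (fun j => x * (g2 j * b' j 0))); last first.
      by move=> j _; rewrite mxE; ring.
    rewrite -mulr_sumr; move: (\sum_i _) (\sum_i _) (\sum_i _) => s1 s2 s3; ring.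
  move=> ->; apply: (annB phi_lin); first apply: (annN phi_lin);
    apply: (ann_sum phi_lin) => i _; apply: annMr; [exact: xW_ann | exact: g2_ann].
rewrite q0 add0r -scale_col_mx in gv vE.
exists (col_mx 0 w - col_mx tc 0), (col_mx (a - c3) (v2' - c4)); split.
  by apply: scalex_eq0; rewrite scalemxAr.
rewrite -vE mulmxBr; move: (b2 *m _) (b2 *m _) (col_mx v1 v2) => s1 s2 s3.
by apply/colP => i; rewrite !mxE; ring.
Qed.

End Exactness.

(** * Generation of the annihilator *)

Section IdealGenerators.
Variables (k : fieldType) (d : nat) (Phi : Dform k).
Local Notation R := {mpoly k[3]}.
Local Notation x := (vx k).
Local Notation y := (vy k).
Local Notation z := (vz k).
Local Notation n := d.+1.
Local Notation phi := (xPhi n Phi).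
Local Notation p := (pmat n Phi).
Local Notation I := (ann phi).
Hypothesis p_unit : p \in unitmx.
Local Notation W := (W Phi).
Local Notation g2 := (g2 Phi).
Local Notation gen := (gen d Phi).
Let phi_lin := xPhi_lin n Phi.

Definition in_gen (f : R) := exists v : 'cV[R]_(n + n.+1), (gen^T *m v) 0 0 = f.

Lemma in_genD f g : in_gen f -> in_gen g -> in_gen (f + g).
Proof. by move=> [v <-] [w <-]; exists (v + w); rewrite mulmxDr mxE. Qed.

Lemma in_genM h f : in_gen f -> in_gen (h * f).
Proof. by move=> [v <-]; exists (h *: v); rewrite -scalemxAr mxE. Qed.

Lemma in_gen0 : in_gen 0.
Proof. by exists 0; rewrite mulmx0 mxE. Qed.

Lemma in_gen_sum J (r : seq J) (F : J -> R) :
  (forall i, in_gen (F i)) -> in_gen (\sum_(i <- r) F i).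
Proof. by move=> H; apply: big_ind => //; [apply: in_gen0 | apply: in_genD]. Qed.

Lemma in_gen_ann f : in_gen f -> I f.
Proof.
move=> [v <-]; rewrite mxE; apply: (ann_sum phi_lin) => i _; apply: annMr.
rewrite mxE -[i]splitK; case: (split i) => {}i /=.
  by rewrite col_mxEu mxE; apply: xW_ann.
by rewrite col_mxEd mxE; apply: g2_ann.
Qed.

Lemma in_gen_xW (i : 'I_n) : in_gen (x * W i).
Proof.
exists (delta_mx (lshift n.+1 i) 0).
by rewrite -colE mxE mxE col_mxEu mxE.
Qed.

Lemma in_gen_g2 (j : 'I_n.+1) : in_gen (g2 j).
Proof.
exists (delta_mx (rshift n j) 0).
by rewrite -colE mxE mxE col_mxEd mxE.
Qed.

(** Subtracting [g2] terms leaves x h' in I with h' of degree d. Then phi (h' m) = 0 whenever x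
    divides m, so h' is determined by its pairings with the [mu] and is a combination of the [W]. *)
Lemma in_gen_degree_n f : f \is n.-homog -> I f -> in_gen f.
Proof.
move=> hf If; have [h hE] := mbas_split (fun l : 'I_(Nn n.+1) => f@_(bexp l)).
rewrite -(homog_mbas hf) in hE.
pose h' := h + \sum_(j < n.+1) f@_(@bexp n (ridx j)) *: u Phi j.
pose G := \sum_(j < n.+1) f@_(@bexp n (ridx j)) *: g2 j.
have fE : f = G + x * h'.
  rewrite {1}hE /h' mulrDr [x * \sum_j _]mulr_sumr addrCA -big_split addrC /=.
  congr (_ + _); apply: eq_bigr => j _; rewrite mbasE bexp_ridx mon3E expr0 mul1r.
  by rewrite /g2 /m0bas -scalerAr -scalerDr subrK.
have inG : in_gen G by apply: in_gen_sum => j; rewrite -mul_mpolyC; apply: in_genM; apply: in_gen_g2.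
have hxh : x * h' \is n.-homog.
  have -> : x * h' = f - G by rewrite fE [G + _]addrC addrK.
  by rewrite rpredB // rpred_sum // => j _; rewrite rpredZ ?g2_homog.
have Ixh : I (x * h').
  have -> : x * h' = f - G by rewrite fE [G + _]addrC addrK.
  by apply: (annB phi_lin) => //; apply: in_gen_ann.
have hh := homog_xM hxh.
suff h'E : h' = \sum_(t < n) phi (h' * mu k t) *: W t.
  rewrite fE; apply: in_genD => //; rewrite h'E mulr_sumr; apply: in_gen_sum => t.
  by rewrite -scalerAr -mul_mpolyC; apply: in_genM; apply: in_gen_xW.
apply/eqP; rewrite -subr_eq0; apply/eqP; apply: (pairing_inj p_unit).
  by rewrite rpredB // rpred_sum // => t _; rewrite rpredZ ?W_homog.
move=> l; rewrite mulrBl (phiB phi_lin) mulr_suml (phi_sum phi_lin).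
have [/existsP[t /eqP ->]|/existsPn lx] := boolP [exists t, l == ridx t].
  rewrite -/(mu k t) (sum_phi_W_mu p_unit (fun t => phi (h' * mu k t))) subrr //.
have [m' mE] : exists m', bexp l = (U_(0%R) + m')%MM.
  exists (bexp l - U_(0%R))%MM; rewrite addmC submK //.
  by apply/mnm_lepP => j; rewrite mnm1E; case: eqP => // <-; apply: bexp_x.
rewrite mbasE mE mpolyXD -/x mulrA [h' * x]mulrC (ann_phi (annMr _ Ixh)) sub0r.
rewrite big1 ?oppr0 // => t _; rewrite -scalerAl (phiZ phi_lin) mulrA [W t * x]mulrC.
by rewrite (ann_phi (annMr _ (xW_ann p_unit t))) mulr0.
Qed.

(* A second Koszul class of [R / I] of degree at most [d] is zero, since there
   [I] vanishes; by Fredholm, [I] has no generator of degree above [d + 1]. *)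
Lemma in_gen_degreeS e f : (n <= e)%N -> (forall g, g \is e.-homog -> I g -> in_gen g) ->
  f \is e.+1.-homog -> I f -> in_gen f.
Proof.
move=> ne IH hf If.
have [f1 [f2 [f3 [fE hf1 hf2 hf3]]]] : exists f1 f2 f3,
    [/\ f = x * f1 + y * f2 + z * f3, f1 \is e.-homog, f2 \is e.-homog & f3 \is e.-homog].
  have [f1 [f2 [f3 E]]] := const_xyz f.
  have f0 : f@_0%MM = 0 by rewrite (dhomog_nemf_coeff hf) //= mdeg0.
  exists (pihomog mdeg e f1), (pihomog mdeg e f2), (pihomog mdeg e f3).
  split; rewrite ?pihomogP // -[LHS](pihomog_dE hf) {1}E.
  by rewrite f0 mpolyC0 add0r !raddfD /= !pihomogXM.
have [|h hE] := @fredholm_ann k 3 phi d.*2 phi_lin (@xPhi_degS k d Phi) 3 3 (curl_mx k) (row3 f1 f2 f3).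
  move=> c Ec; have [c0 c1 c2] := curl_mulE c.
  have := Ec 0; have := Ec 1; have := Ec 2; rewrite c0 c1 c2 => {c0 c1 c2 Ec}.
  rewrite row3_mul; move: (c 0 0) (c 1 0) (c 2 0) => {}c1 c2 c3 C3 C2 C1.
  have [le|lt] := leqP e d.*2; last first.
    have hi g : g \is e.-homog -> I g by move=> hg; apply: (ann_high phi_lin (@xPhi_degS k d Phi) hg).
    by apply: ann_phi; apply: (annD phi_lin); [apply: (annD phi_lin)|]; apply: annMr; apply: hi.
  (* The degree complementary to e, the only part of c that phi sees against f1, f2, f3. *)
  pose a := (d.*2 - e)%N; pose H (c : R) := pihomog mdeg a c.
  have phiH g c' : g \is e.-homog -> phi (g * c') = phi (g * H c').
    move=> hg; rewrite (phi_pihomog phi_lin (@xPhi_degS k d Phi) (g * c')) -(subnKC le).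
    by rewrite (pihomog_Mhomog _ _ hg).
  (* Since e > d, a + 1 is at most d, where I vanishes; the curl of the cut c is thus exactly
     zero. *)
  have z0 g : I g -> pihomog mdeg a.+1 g = 0.
    move=> Ig; apply: (ann_low p_unit (pihomogP mdeg a.+1 g)); first by rewrite /a; lia.
    exact: (ann_pihomog phi_lin (@xPhi_degS k d Phi)).
  have := z0 _ C1; have := z0 _ C2; have := z0 _ C3; rewrite !raddfB /= !pihomogXM.
  rewrite -/(H c1) -/(H c2) -/(H c3) => /subr0_eq e3 /subr0_eq e2 /subr0_eq e1.
  have [t [t1 t2 t3]] := koszul2 e1 e2 e3.
  rewrite !(phiD phi_lin) (phiH _ c1 hf1) (phiH _ c2 hf2) (phiH _ c3 hf3) t1 t2 t3 -!(phiD phi_lin).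
  have -> : f1 * (x * t) + f2 * (y * t) + f3 * (z * t) = t * f by rewrite fE; ring.
  exact: If.
have [h0 h1 h2] := mul_curlE h.
have A0 := hE 0; have A1 := hE 1; have A2 := hE 2.
rewrite mxE [X in _ + X]mxE h0 [X in X - _]mxE /= in A0.
rewrite mxE [X in _ + X]mxE h1 [X in X - _]mxE /= in A1.
rewrite mxE [X in _ + X]mxE h2 [X in X - _]mxE /= in A2.
have H g : I g -> in_gen (pihomog mdeg e g).
  move=> Ig; apply: IH; first exact: pihomogP.
  exact: (ann_pihomog phi_lin (@xPhi_degS k d Phi)).
move: A0 A1 A2; set i1 := f1 - _; set i2 := f2 - _; set i3 := f3 - _ => A0 A1 A2.
have E : f = x * i1 + y * i2 + z * i3 by rewrite fE /i1 /i2 /i3; ring.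
clearbody i1 i2 i3.
have -> : f = x * pihomog mdeg e i1 + y * pihomog mdeg e i2 + z * pihomog mdeg e i3.
  by rewrite -[LHS](pihomog_dE hf) {1}E !raddfD /= !pihomogXM.
by apply: in_genD; [apply: in_genD|]; apply: in_genM; apply: H.
Qed.

Lemma in_gen_homog e f : f \is e.-homog -> I f -> in_gen f.
Proof.
elim: e f => [|e IH] f hf If.
  by rewrite (ann_low p_unit hf _ If) //; apply: in_gen0.
have [le|lt] := ltnP e d; first by rewrite (ann_low p_unit hf _ If) //; apply: in_gen0.
move: lt; rewrite leq_eqVlt => /orP[/eqP de|lt].
  by apply: in_gen_degree_n; rewrite // de.
exact: (in_gen_degreeS lt IH).
Qed.

Lemma ann_in_gen f : I f <-> in_gen f.
Proof.
split=> [If|]; last exact: in_gen_ann.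
rewrite (pihomog_partitionE (leqnn (mmeasure mdeg f))); apply: in_gen_sum => e.
apply: (in_gen_homog (pihomogP mdeg e f)).
exact: (ann_pihomog phi_lin (@xPhi_degS k d Phi)).
Qed.

End IdealGenerators.

Lemma pfaff_rmorph (S T : comPzRingType) (f : {rmorphism S -> T}) s (a : nat -> nat -> S) :
  f (pfaff s a) = pfaff s (fun i j => f (a i j)).
Proof.
elim/ltn_ind: s a => -[|[|s]] IH a /=; rewrite ?rmorph1 ?rmorph0 //.
rewrite rmorph_sum; apply: eq_bigr => j _.
by rewrite !rmorphM rmorphXn rmorphN rmorph1 IH.
Qed.

Lemma pfaff_homog (k : fieldType) m s (a : nat -> nat -> {mpoly k[m]}) :
  (forall i j, a i j \is 1.-homog) -> pfaff s a \is (s./2).-homog.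
Proof.
elim/ltn_ind: s a => -[|[|s]] IH a ha /=; rewrite ?rpred0 ?dhomog1 //.
apply: rpred_sum => j _; rewrite -mulrA -signr_odd mulr_sign.
have h : a 0%N j.+1 * pfaff s (minor2 a j) \is (1 + s./2)%N.-homog.
  by apply: dhomogM => //; apply: IH => // i l; apply: ha.
by case: odd; rewrite ?rpredN -add1n.
Qed.

(** The first row has a single nonzero entry and its minor has the same shape, so the value is a
    sign in every characteristic. *)
Lemma pfaff_symplectic_neq0 (k : fieldType) m (a : nat -> nat -> k) :
  (forall i j, (i < m.*2)%N -> (j < m.*2)%N ->
     a i j = (j == i + m)%N%:R - (i == j + m)%N%:R) ->
  pfaff m.*2 a != 0.
Proof.
elim: m a => [|m IH] a ha; first exact: oner_neq0.
rewrite doubleS; have lt : (m < (m.*2).+1)%N by lia.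
rewrite [pfaff _ _]/= (bigD1 (Ordinal lt)) //= big1 ?addr0 => [|j jm].
  rewrite ha ?doubleS //.
  have -> : (m.+1 == 0 + m.+1)%N by lia.
  have -> : (0 == m.+1 + m.+1)%N = false by lia.
  rewrite subr0 mulr1 mulf_neq0 ?signr_eq0 //; apply: IH => i j lti ltj.
  rewrite /minor2 ha ?doubleS; try by case: ifP; lia.
  by congr (_%:R - _%:R); congr nat_of_bool; do 2!case: ifP; lia.
have ltj := ltn_ord j; rewrite ha ?doubleS ?ltnS //.
have -> : (j.+1 == 0 + m.+1)%N = false.
  by apply: contraNF jm => /eqP E; apply/eqP/val_inj => /=; lia.
have -> : (0 == j.+1 + m.+1)%N = false by lia.
by rewrite subrr mulr0 mul0r.
Qed.

(** * Comparison with the Pfaffians *)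

Section Comparison.
Variables (k : fieldType) (d : nat) (Phi : Dform k).
Local Notation R := {mpoly k[3]}.
Local Notation x := (vx k).
Local Notation y := (vy k).
Local Notation z := (vz k).
Local Notation n := d.+1.
Local Notation gen := (gen d Phi).
Local Notation b2 := (b2 n Phi).
Local Notation pf := (signed_pfaffians b2).

Lemma pf_homog i j : pf i j \is n.-homog.
Proof.
rewrite mxE -signr_odd mulr_sign.
have h : pfaffian (row' j (col' j b2)) \is ((n + n.+1).-1./2)%N.-homog.
  apply: pfaff_homog => a b; rewrite /mx_fun; case: insub => [a'|]; last exact: rpred0.
  by case: insub => [b'|]; rewrite ?rpred0 // mxE mxE b2_homog.
have e : (n + n.+1).-1./2 = n by lia.
rewrite e in h.
by case: odd; rewrite ?rpredN.
Qed.

Definition pt001 : 'I_3 -> k := fun i => (i == 2)%:R.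

Lemma b2_pt001 (i j : 'I_(n + n.+1)) : (i < n.*2)%N -> (j < n.*2)%N ->
  (b2 i j).@[pt001] = (j == i + n :> nat)%N%:R - (i == j + n :> nat)%N%:R.
Proof.
have ex (c : R) : (x * c).@[pt001] = 0 by rewrite mevalM mevalXU /pt001 /= mul0r.
have eB (i' : 'I_n) (j' : 'I_n.+1) : (Bmx n Phi i' j').@[pt001] = (j' == i' :> nat)%:R.
  rewrite mxE mevalD [X in X.@[_] + _]mxE ex add0r B2E mevalB !mevalMn !mevalXU /pt001 /=.
  by rewrite mul0rn subr0.
rewrite -[i]splitK -[j]splitK; case: (split i) => {}i; case: (split j) => {}j /= lti ltj.
- rewrite block_mxEul mxE ex.
  by rewrite !ltn_eqF ?subrr // ltn_addl.
- rewrite block_mxEur eB.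
  have -> : (i == n + j + n :> nat) = false by have := ltn_ord i; lia.
  by rewrite subr0 addnC eqn_add2r.
- rewrite block_mxEdl mxE mevalN mxE eB.
  have -> : (j == n + i + n :> nat) = false by have := ltn_ord j; lia.
  by rewrite sub0r addnC eqn_add2r.
- rewrite block_mxEdr mxE ex.
  have -> : (n + j == n + i + n)%N = false by lia.
  have -> : (n + i == n + j + n)%N = false by lia.
  by rewrite subrr.
Qed.

(** The last Pfaffian is the one to test: at (0, 0, 1) the matrix without its last row and column is
    the standard symplectic one. *)
Lemma pf_neq0 : pf != 0.
Proof.
apply/eqP => /rowP/(_ (rshift n ord_max)) /eqP; rewrite [X in _ == X]mxE mxE.
set j0 := rshift n ord_max; rewrite mulf_eq0 signr_eq0 /=; apply/negP.
suff : (pfaffian (row' j0 (col' j0 b2))).@[pt001] != 0.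
  by apply: contra => /eqP ->; rewrite meval0.
rewrite /pfaffian (pfaff_rmorph (meval pt001)).
pose a i j := (mx_fun (row' j0 (col' j0 b2)) i j).@[pt001].
have e : (n + n.+1).-1 = n.*2 by lia.
have aE i j : (i < n.*2)%N -> (j < n.*2)%N ->
    a i j = (j == i + n)%N%:R - (i == j + n)%N%:R.
  move=> lti ltj; have lti' : (i < (n + n.+1).-1)%N by rewrite e.
  have ltj' : (j < (n + n.+1).-1)%N by rewrite e.
  rewrite /a -[i]/(val (Ordinal lti')) -[j]/(val (Ordinal ltj')) mx_funE mxE mxE.
  have lv (l : 'I_(n + n.+1).-1) : lift j0 l = l :> nat.
    by have := ltn_ord l; rewrite /j0 /= /bump /=; lia.
  by rewrite b2_pt001 !lv.
rewrite -/a; clearbody a; rewrite e; exact: pfaff_symplectic_neq0.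
Qed.

Hypothesis p_unit : pmat n Phi \in unitmx.

(** Both vectors are homogeneous of degree n, so the polynomial factor given by [ker_b2] can be
    replaced by its constant term. *)
Lemma pf_gen : exists2 c : k, c != 0 & pf^T = c%:MP *: gen.
Proof.
have /(ker_b2 p_unit)[s sE] : b2 *m pf^T = 0.
  apply: trmx_inj; rewrite trmx_mul trmxK b2_skew mulmxN trmx0.
  by rewrite (signed_pfaffians_mul0 (b2_skew _ _) (b2_diag _)) oppr0.
have E : pf^T = ((s 0 0)@_0%MM)%:MP *: gen.
  apply/colP => i; rewrite [RHS]mxE mxE -[LHS](pihomog_dE (pf_homog _ _)).
  have -> : pf 0 i = gen i 0 * s 0 0.
    by move/colP/(_ i): sE; rewrite mxE => ->; rewrite mxE big_ord1.
  have := pihomog_Mhomog 0 (s 0 0) (gen_homog_mx Phi i 0).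
  by rewrite addn0 => ->; rewrite pihomog_const mulrC.
exists ((s 0 0)@_0%MM) => //; apply: contra pf_neq0 => /eqP c0.
by rewrite -[pf]trmxK E c0 mpolyC0 scale0r trmx0.
Qed.

End Comparison.

Lemma homog_in_maxideal (k : fieldType) r c e (M : 'M[{mpoly k[3]}]_(r, c)) : (0 < e)%N ->
  (forall i j, M i j \is e.-homog) -> in_maxideal M.
Proof.
move=> e0 hM i j; rewrite (dhomog_nemf_coeff (hM i j)) //= mdeg0.
by rewrite eq_sym -lt0n.
Qed.

Lemma homog_graded_map (k : fieldType) r c a b (M : 'M[{mpoly k[3]}]_(r, c)) : (a <= b)%N ->
  (forall i j, M i j \is (b - a)%N.-homog) ->
  graded_map (fun=> a) (fun=> b) M.
Proof. by move=> ab hM i j; right. Qed.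

Lemma pfaffian_resolution (k : fieldType) d (Phi : Dform k) (n := d.+1) :
  pmat n Phi \in unitmx ->
  min_graded_res3 (annI n Phi)
    (fun _ : 'I_(n + n.+1) => n) (fun _ : 'I_(n + n.+1) => n.+1)
    (fun _ : 'I_1 => (2 * n + 1)%N)
    (signed_pfaffians (b2 n Phi)) (b2 n Phi) (signed_pfaffians (b2 n Phi))^T.
Proof.
move=> p_unit; have [c c0 pfE] := pf_gen p_unit.
set pf := signed_pfaffians _ in pfE *.
have pfE' : pf = c%:MP *: (gen d Phi)^T by rewrite -[pf]trmxK pfE linearZ.
have cc : c%:MP * (c^-1)%:MP = 1 :> {mpoly k[3]} by rewrite -mpolyCM divff // mpolyC1.
have cI r1 r2 (M : 'M[{mpoly k[3]}]_(r1, r2)) : c%:MP *: M = 0 -> M = 0.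
  by move=> E; rewrite -[M]scale1r -cc mulrC -scalerA E scaler0.
have hpf := pf_homog Phi.
have gmul v : pf *m v = c%:MP *: ((gen d Phi)^T *m v) by rewrite pfE' -scalemxAl.
have exact1 : exact_at pf (b2 n Phi).
  move=> v; rewrite gmul; split=> [/cI/(ker_gen p_unit) //|[w ->]].
  by rewrite mulmxA gen_b2 // mul0mx scaler0.
have exact2 : exact_at (b2 n Phi) pf^T.
  move=> v; rewrite pfE; split=> [/(ker_b2 p_unit)[s ->]|[w ->]].
    exists ((c^-1)%:MP *: s).
    by rewrite -scalemxAl -scalemxAr scalerA cc scale1r.
  by rewrite mulmxA -scalemxAr b2_gen // scaler0 mul0mx.
have image : image_is pf (annI n Phi).
  move=> mu; rewrite annIE // (ann_in_gen p_unit); split=> [[v vE]|[v vE]].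
    exists ((c^-1)%:MP *: v); rewrite gmul -scalemxAr scalerA cc scale1r.
    by apply/matrixP => i j; rewrite !ord1 [RHS]mxE vE.
  exists (c%:MP *: v); rewrite -scalemxAr mxE.
  by have := congr1 (fun M : 'M_1 => M 0 0) vE; rewrite gmul mxE => ->; rewrite mxE.
split.
- split=> //.
  + by apply: homog_graded_map => // i j; rewrite subn0; apply: hpf.
  + by apply: homog_graded_map => [|i j]; rewrite ?leqnSn // subSnn b2_homog.
  + split; first by apply: (@homog_in_maxideal _ _ _ d.+1) => // i j; apply: hpf.
    by apply: (@homog_in_maxideal _ _ _ 1) => // i j; apply: b2_homog.
- apply: homog_graded_map => [|i j]; first by lia.
  have -> : (2 * n + 1 - n.+1 = d.+1)%N by rewrite /n; lia.
  by rewrite mxE; apply: hpf.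
- by apply: (@homog_in_maxideal _ _ _ d.+1) => // i j; rewrite mxE; apply: hpf.
- exact: exact2.
move=> w wE; have /rV0Pn[i pfi] := pf_neq0 d Phi.
apply/colP => j; rewrite !ord1 [RHS]mxE.
have := congr1 (fun M : 'cV_(n + n.+1) => M i 0) wE; rewrite mxE big_ord1 [RHS]mxE mxE.
by move=> /eqP; rewrite mulf_eq0 (negbTE pfi) => /eqP.
Qed.

Theorem theorem3p1 (k : fieldType) (n : nat) (hn : (0 < n)%N) (Phi : Dform k) :
  (linearly_presented (annI n Phi) <-> pmat n Phi \in unitmx) /\
  (pmat n Phi \in unitmx ->
   let B2 := b2 n Phi in
   let B1 := signed_pfaffians B2 in
   let B3 := B1^T in
   min_graded_res3 (annI n Phi)
     (fun _ : 'I_(n + n.+1) => n) (fun _ : 'I_(n + n.+1) => n.+1)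
     (fun _ : 'I_1 => (2 * n + 1)%N) B1 B2 B3).
Proof.
case: n hn => // d _; split; last exact: pfaffian_resolution.
split=> [[r1 [r2 [a [b [d1 [d2 [[g1 g2 m im ex] lin]]]]]]]|p_unit].
  have lp : linearly_presented (ann (xPhi d.+1 Phi)).
    exists r1, r2, a, b, d1, d2; split=> //; split=> // mu.
    by rewrite -annIE //; apply: im.
  apply: pmat_unit => f If hf.
  exact: (linearly_presented_ann (xPhi_lin _ _) (@xPhi_degS k d Phi) lp If hf).
have [pres _ _ _ _] := pfaffian_resolution p_unit.
do 6!eexists; split; first exact: pres.
exact: b2_homog.
Qed.
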